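(* Let $\{g_t,\ t\in(-\epsilon,\epsilon)\}\subset\mathrm{Riem}(M,\mathcal V,g_0)$ be a variation such that $\pi:(M,g_t)\to(N,g_N)$ is a Riemannian submersion for all $t\in(-\epsilon,\epsilon)$ and, for every vertical $X$, $$B_t^\sharp X=\sum_{i=n+1}^{n+p}g_0(V_i,X)\,P^t_{\mathcal H}\pi^*W_i ,$$ where $\{W_{n+1},\dots,W_{n+p}\}$ are $g_N$-orthonormal vector fields on $N$ and $\{V_{n+1},\dots,V_{n+p}\}$ are bounded vertical vector fields whose restrictions to every fiber $\mathcal F_x$ are Killing fields on $(\mathcal F_x,g_0|_{\mathcal F_x})$. Let the fibers of $\pi:(M,g_0)\to(N,g_N)$ be totally geodesic. Suppose that $\partial_tV_i=0$ for all $i\in\{n+1,\dots,n+p\}$. Write $W_i^t=P^t_{\mathcal H}\pi^*W_i$ and, for vertical $U$, $$\Phi_{ij}(U)=\sum_{k=n+1}^{n+p}g_N([W_i,W_j],W_k)\,g_0(V_k,U)-g_t\big([V_i,W_j^t]+[W_i^t,V_j],U\big).$$ (All sums below run over $n+1,\dots,n+p$, and functions on $N$ are pulled back to $M$.) Then for all $U\in\mathfrak X_{\mathcal V}$, all $U_1,U_2\in\mathfrak X_{\mathcal V}$, and all indices $i,j,l$ in $\{n+1,\dots,n+p\}$ that are not summed over: (a) Vertizontal curvatures: $$\partial^2_{t}\sec_{(M,g_t)}(W_i^t,U)=\tfrac12\sum_j\Phi_{ij}(U)^2+\sum_jg_t([W_i^t,W_j^t],U)\,g_t([V_i,V_j],U),$$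 $$\partial^3_{t}\sec_{(M,g_t)}(W_i^t,U)=3\sum_j\Phi_{ij}(U)\,g_t([V_i,V_j],U),$$ $$\partial^4_{t}\sec_{(M,g_t)}(W_i^t,U)=6\sum_jg_t([V_i,V_j],U)^2,\qquad \partial^5_t\sec_{(M,g_t)}(W_i^t,U)=0.$$ (b) Horizontal curvatures: $$\partial^2_t\sec_{(M,g_t)}(W_i^t,W_j^t)=-\tfrac32\sum_{k,l}g_N([W_i,W_j],W_k)g_N([W_i,W_j],W_l)g_0(V_k,V_l)$$ $$+3\sum_kg_N([W_i,W_j],W_k)\,g_t\big(V_k,[V_i,W_j^t]+[W_i^t,V_j]\big)-3g_t\big([V_i,V_j],P^t_{\mathcal V}[W_i^t,W_j^t]\big)$$ $$-\tfrac32g_t\big([V_i,W_j^t]+[W_i^t,V_j],[V_i,W_j^t]+[W_i^t,V_j]\big),$$ $$\partial^3_t\sec_{(M,g_t)}(W_i^t,W_j^t)=-9\sum_kg_N([W_i,W_j],W_k)g_0(V_k,[V_i,V_j])+9g_t\big([V_i,W_j^t]+[W_i^t,V_j],[V_i,V_j]\big),$$ $$\partial^4_t\sec_{(M,g_t)}(W_i^t,W_j^t)=-18\,g_t([V_i,V_j],[V_i,V_j]),\qquad\partial_t^5\sec_{(M,g_t)}(W_i^t,W_j^t)=0.$$ (c) Components of the O'Neill tensor: $$4\,\partial_t^2g_t(\mathcal A^t_{W_i^t}U_1,\mathcal A^t_{W_l^t}U_2)=2\sum_j\Phi_{lj}(U_2)\Phi_{ij}(U_1)+2\sum_jg_t(P^t_{\mathcal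 V}[W_l^t,W_j^t],U_2)\,g_t([V_i,V_j],U_1)$$ $$+2\sum_jg_t(P^t_{\mathcal V}[W_i^t,W_j^t],U_1)\,g_t([V_l,V_j],U_2),$$ $$4\,\partial_t^3g_t(\mathcal A^t_{W_i^t}U_1,\mathcal A^t_{W_l^t}U_2)=4\sum_jg_t([V_l,V_j],U_2)\Phi_{ij}(U_1)+4\sum_jg_t([V_i,V_j],U_1)\Phi_{lj}(U_2)$$ $$+2\sum_j\Phi_{lj}(U_2)\,g_t([V_i,V_j],U_1)+2\sum_j\Phi_{ij}(U_1)\,g_t([V_l,V_j],U_2),$$ $$4\,\partial_t^4g_t(\mathcal A^t_{W_i^t}U_1,\mathcal A^t_{W_l^t}U_2)=24\sum_jg_t([V_l,V_j],U_2)\,g_t([V_i,V_j],U_1),$$ and $\partial_t^5g_t(\mathcal A^t_{W_i^t}U_1,\mathcal A^t_{W_l^t}U_2)=0$.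
   Context: $M$, $N$ are smooth, connected, oriented manifolds, $\dim M=n+p$, $\dim N=p$; all functions and tensor fields are smooth. $\pi:(M,g_0)\to(N,g_N)$ is a Riemannian submersion with fibers $\mathcal F_x=\pi^{-1}(\{x\})$; $\mathcal V$ is the vertical distribution and $\mathfrak X_{\mathcal V}$ the set of vertical vector fields. $\mathrm{Riem}(M,\mathcal V,g_0)$ is the set of metrics $g$ on $M$ with $g(X,Y)=g_0(X,Y)$ for all vertical $X,Y$. A variation of $g_0$ is a one-parameter family $g_t$ in this set (equal to $g_0$ at $t=0$), smooth in $t$. $\mathcal H(t)$ is the $g_t$-orthogonal complement of $\mathcal V$; $P^t_{\mathcal V},P^t_{\mathcal H}$ are the $g_t$-orthogonal projections onto $\mathcal V$, $\mathcal H(t)$. $\pi:(M,g_t)\to(N,g_N)$ is a Riemannian submersion if $g_t(X,Y)=g_N(\pi_*X,\pi_*Y)$ for $X,Y$ in $\mathcal H(t)$. $B_t=\partial_tg_t$ and $g_t(B_t^\sharp X,Y)=B_t(X,Y)$. For a vector field $W$ on $N$, $\pi^*W$ is its $g_0$-horizontal lift. A vector field $V$ is bounded if $g_0(V,V)$ is a bounded function. $\nabla^t$ is the Levi-Civita connection of $g_t$, and $\mathcal A^t_XY=P^t_{\mathcal V}\nabla^t_{P^t_{\mathcal H}X}P^t_{\mathcal H}Y+P^t_{\mathcal H}\nabla^t_{P^t_{\mathcal H}X}P^t_{\mathcal V}Y$. $\sec_{(M,g_t)}(X,Y)$ is the sectional curvature of the plane spanned by linearly independent $X,Y$; it is called vertizontal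 if $X$ is in $\mathcal H(t)$ and $Y$ is in $\mathcal V$, and horizontal if both are in $\mathcal H(t)$. For such submersions with totally geodesic fibers the vertizontal curvature is given by the formula $\sec_{(M,g_t)}(X,U)=g_t(\mathcal A^t_XU,\mathcal A^t_XU)$ for $X$ in $\mathcal H(t)$ and $U$ in $\mathcal V$.
   Formalization: In (a) the right-hand sides are quadratic in U while sec depends only on the plane, so the printed formulas fail for non-unit U; (a) is stated for g_0(U,U)·sec(W_i^t,U) instead, which is the printed claim when U is a unit vector. *)

(* Defs.v *)
(* Stated in Mathematical Components with MathComp-Analysis, over an arbitrary
   R : realType. *)
From HB Require Import structures.
From mathcomp Require Import all_boot all_order all_algebra.
From mathcomp Require Import all_classical all_reals all_analysis.
From mathcomp Require Import ring lra.
Set Implicit Arguments.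
Unset Strict Implicit.
Unset Printing Implicit Defensive.
Import Order.TTheory GRing.Theory Num.Theory.
Import numFieldNormedType.Exports.
Local Open Scope classical_set_scope.
Local Open Scope ring_scope.

Section Calculus.
Context {R : realType}.

Definition evec {m : nat} (i : 'I_m) : 'rV[R]_m := delta_mx 0 i.

(* f is k times continuously differentiable on O (meant for open O): f and all
   its iterated partial derivatives of order <= k exist and are continuous. *)
Fixpoint Ck {m : nat} (k : nat) (O : set 'rV[R]_m) (f : 'rV[R]_m -> R) : Prop :=
  {in O, continuous f} /\
  if k is k'.+1 then
    forall i, (forall x, O x -> derivable f x (evec i)) /\
              Ck k' O (fun x => 'D_(evec i) f x)
  else True.

Definition smooth_on {m : nat} (O : set 'rV[R]_m) (f : 'rV[R]_m -> R) : Prop :=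
  forall k, Ck k O f.

Lemma Ck_cont m k (O : set 'rV[R]_m) f : Ck k O f -> {in O, continuous f}.
Proof. by case: k => [|k] []. Qed.

Lemma CkS m k (O : set 'rV[R]_m) f : Ck k.+1 O f -> Ck k O f.
Proof.
elim: k f => [|k IH] f [fc fd]; split=> // i.
by have [? ?] := fd i; split=> //; exact: IH.
Qed.

Lemma Ck_sub m k (O O' : set 'rV[R]_m) f : O `<=` O' -> Ck k O' f -> Ck k O f.
Proof.
move=> OO'; elim: k f => [|k IH] f [fc fd]; split=> //.
- by move=> x /set_mem Ox; apply: fc; exact/mem_set/OO'.
- by move=> x /set_mem Ox; apply: fc; exact/mem_set/OO'.
- by move=> i; have [h1 h2] := fd i; split; [move=> x /OO'; exact: h1|exact: IH].
Qed.

Lemma near_eq_continuous (T : topologicalType) (f g : T -> R) (x : T) :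
  {near x, f =1 g} -> {for x, continuous f} -> {for x, continuous g}.
Proof.
move=> fg fc; rewrite /prop_for /continuous_at -(nbhs_singleton fg).
exact: cvg_trans (near_eq_cvg fg) fc.
Qed.

Lemma Ck_ext m k (O : set 'rV[R]_m) f g : open O ->
  (forall x, O x -> f x = g x) -> Ck k O f -> Ck k O g.
Proof.
move=> oO; elim: k f g => [|k IH] f g fg [fc fd].
  split=> // x Ox; apply: near_eq_continuous (fc x Ox).
  by apply: filterS (open_nbhs_nbhs (conj oO (set_mem Ox))).
have nfg x : O x -> {near x, f =1 g}.
  by move=> Ox; apply: filterS (open_nbhs_nbhs (conj oO Ox)).
split=> [x Ox|i]; first exact: near_eq_continuous (nfg _ (set_mem Ox)) (fc x Ox).
have [h1 h2] := fd i; split.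
  by move=> x Ox; apply: near_eq_derivable (h1 x Ox); exact: nfg.
by apply: IH h2 => x Ox; apply: near_eq_derive; exact: nfg.
Qed.

Lemma Ck_cst m k (O : set 'rV[R]_m) (c : R) : Ck k O (fun=> c).
Proof.
elim: k c => [|k IH] c; split=> //.
- by move=> x _; exact: cst_continuous.
- by move=> x _; exact: cst_continuous.
move=> i; split=> [x _|]; first exact: derivable_cst.
suff -> : (fun x => 'D_(evec i) (fun=> c) x) = fun=> 0 :> R by exact: IH.
by apply/funext => x; rewrite derive_cst.
Qed.

Lemma Ck_add m k (O : set 'rV[R]_m) f g : open O ->
  Ck k O f -> Ck k O g -> Ck k O (fun x => f x + g x).
Proof.
move=> oO; elim: k f g => [|k IH] f g [fc fd] [gc gd].
  by split=> // x Ox; apply: continuousD; [exact: fc|exact: gc].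
split=> [x Ox|i]; first by apply: continuousD; [exact: fc|exact: gc].
have [f1 f2] := fd i; have [g1 g2] := gd i; split.
  by move=> x Ox; apply: derivableD; auto.
apply: Ck_ext (IH _ _ f2 g2) => // x Ox.
by rewrite -deriveD; auto.
Qed.

Lemma Ck_mul m k (O : set 'rV[R]_m) f g : open O ->
  Ck k O f -> Ck k O g -> Ck k O (fun x => f x * g x).
Proof.
move=> oO; elim: k f g => [|k IH] f g cf cg.
  split=> // x Ox; apply: continuousM; [exact: (Ck_cont cf)|exact: (Ck_cont cg)].
split=> [x Ox|i].
  by apply: continuousM; [exact: (Ck_cont cf)|exact: (Ck_cont cg)].
have [_ /(_ i)[f1 f2]] := cf; have [_ /(_ i)[g1 g2]] := cg; split.
  by move=> x Ox; apply: derivableM; auto.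
apply: (@Ck_ext _ _ _ (fun x => f x * 'D_(evec i) g x + g x * 'D_(evec i) f x))
  => // [x Ox|].
  by rewrite (@deriveM _ _ f g x) //; auto.
by apply: Ck_add => //; apply: IH => //; exact: CkS.
Qed.

Lemma Ck_sum m k (O : set 'rV[R]_m) (I : Type) (r : seq I)
    (f : I -> 'rV[R]_m -> R) : open O ->
  (forall i, Ck k O (f i)) -> Ck k O (fun x => \sum_(i <- r) f i x).
Proof.
move=> oO cf; elim: r => [|i r IH].
  rewrite (_ : (fun x => _) = fun=> 0); first exact: Ck_cst.
  by apply/funext => x; rewrite big_nil.
rewrite (_ : (fun x => _) = fun x => f i x + \sum_(i <- r) f i x).
  exact: Ck_add.
by apply/funext => x; rewrite big_cons.
Qed.

Lemma derive_line (V : normedModType R) (F : V -> R) (b v : V) (t : R) :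
  derivable F (b + t *: v) v ->
  is_derive t 1 (fun s : R => F (b + s *: v)) ('D_v F (b + t *: v)).
Proof.
move=> dF.
have E : (fun h : R => h^-1 *: (((fun s : R => F (b + s *: v)) \o shift t) (h *: 1)
            - F (b + t *: v))) =
         (fun h : R => h^-1 *: ((F \o shift (b + t *: v)) (h *: v)
            - F (b + t *: v))).
  apply/funext => h /=; congr (_ *: (F _ - _)).
  by rewrite [h *: 1]mulr1 scalerDl addrCA addrA addrC addrCA addrA.
by split; rewrite /derivable /derive E.
Qed.

Lemma mvt_line (V : normedModType R) (F : V -> R) (b v : V) (s : R) :
  (forall t, `|t| <= `|s| -> derivable F (b + t *: v) v) ->
  exists2 t, `|t| <= `|s| & F (b + s *: v) - F b = s * 'D_v F (b + t *: v).
Proof.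
have pos (c : V) (r : R) : 0 <= r ->
    (forall t, 0 <= t <= r -> derivable F (c + t *: v) v) ->
    exists2 t, 0 <= t <= r & F (c + r *: v) - F c = r * 'D_v F (c + t *: v).
  move=> r0 dF.
  have [|x|t] := @MVT_segment R (fun t => F (c + t *: v))
      (fun t => 'D_v F (c + t *: v)) 0 r r0.
  - move=> x; rewrite in_itv/= => /andP[x0 xr]; apply: derive_line.
    by apply: dF; rewrite !ltW.
  - apply: derivable_within_continuous => t; rewrite in_itv/= => tr.
    by have [] := derive_line (dF t tr).
  - rewrite in_itv/= => tr; rewrite scale0r addr0 subr0 mulrC => ->.
    by exists t.
move=> dF; have [s0|s0] := leP 0 s.
  have [t tr|t /andP[t0 ts] ->] := pos b s s0.
    by case/andP: tr => t0 ts; apply: dF; rewrite !ger0_norm.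
  by exists t => //; rewrite !ger0_norm.
have [|t tr|t /andP[t0 ts]] := pos (b + s *: v) (- s).
- by rewrite oppr_ge0 ltW.
- case/andP: tr => t0 ts; rewrite -addrA -scalerDl; apply: dF.
  by rewrite !ler0_norm; lra.
rewrite -!addrA -!scalerDl subrr scale0r addr0 => e.
exists (s + t); first by rewrite !ler0_norm; lra.
by rewrite -opprB e mulNr opprK.
Qed.

Lemma derive_shiftv (V : normedModType R) (F : V -> R) (c a v : V) :
  derivable F (a + c) v ->
  is_derive a v (fun x => F (x + c)) ('D_v F (a + c)).
Proof.
move=> dF.
have E : (fun h : R => h^-1 *: (((fun x => F (x + c)) \o shift a) (h *: v)
            - F (a + c))) =
         (fun h : R => h^-1 *: ((F \o shift (a + c)) (h *: v) - F (a + c))).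
  by apply/funext => h /=; rewrite addrA.
by split; rewrite /derivable /derive E.
Qed.

Lemma second_difference (V : normedModType R) (f fu fuv : V -> R) (a u v : V)
    (s : R) :
  (forall t r, `|t| <= `|s| -> `|r| <= `|s| ->
     is_derive (a + t *: u + r *: v) u f (fu (a + t *: u + r *: v)) /\
     is_derive (a + t *: u + r *: v) v fu (fuv (a + t *: u + r *: v))) ->
  exists t r, [/\ `|t| <= `|s|, `|r| <= `|s| &
    f (a + s *: u + s *: v) - f (a + s *: u) - (f (a + s *: v) - f a) =
    s * (s * fuv (a + t *: u + r *: v))].
Proof.
move=> df.
have dF t : `|t| <= `|s| -> is_derive (a + t *: u) u
    (fun x => f (x + s *: v) - f x)
    (fu (a + t *: u + s *: v) - fu (a + t *: u)).
  move=> ts; have [[h1 h2] _] := df t s ts (lexx _).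
  have [] := df t 0 ts; rewrite ?normr0// scale0r addr0 => h3 _.
  by apply: is_deriveB => //; rewrite -h2; exact: derive_shiftv.
have [t ts Et] := @mvt_line V (fun x => f (x + s *: v) - f x) a u s
  (fun t ts => @ex_derive _ _ _ _ _ _ _ (dF t ts)).
have [r rs Er] := @mvt_line V fu (a + t *: u) v s
  (fun r rs => @ex_derive _ _ _ _ _ _ _ (df t r ts rs).2).
exists t, r; split=> //.
have [_ <-] := (df t r ts rs).2.
rewrite -Er; have [_ <-] := dF t ts.
exact: Et.
Qed.

Lemma schwarz (V : normedModType R) (f fu fv fuv fvu : V -> R) (a u v : V) :
  (\forall x \near a, [/\ is_derive x u f (fu x), is_derive x v f (fv x),
      is_derive x v fu (fuv x) & is_derive x u fv (fvu x)]) ->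
  {for a, continuous fuv} -> {for a, continuous fvu} -> fuv a = fvu a.
Proof.
move=> nd c1 c2.
apply/eqP; rewrite -subr_eq0 -normr_le0; apply/ler_addgt0Pl => e e0.
rewrite addr0.
have e2 : 0 < e / 2 by rewrite divr_gt0.
move/cvgrPdist_lt : c1 => /(_ _ e2) c1; move/cvgrPdist_lt : c2 => /(_ _ e2) c2.
have [d /= d0 H] := (nbhs_normP _ _).1 (filterI nd (filterI c1 c2)).
have uv0 : 0 < `|u| + `|v| + 1 by rewrite ltr_wpDl// addr_ge0.
pose s := d / (`|u| + `|v| + 1) / 2.
have s0 : 0 < s by rewrite !divr_gt0.
have near_a t r : `|t| <= `|s| -> `|r| <= `|s| -> `|a - (a + t *: u + r *: v)| < d.
  rewrite (gtr0_norm s0) => ts rs; rewrite -addrA opprD addrA subrr sub0r normrN.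
  apply: le_lt_trans (ler_normD _ _) _; rewrite !normrZ.
  apply: (@le_lt_trans _ _ (s * (`|u| + `|v| + 1))).
    by rewrite !mulrDr mulr1 -[leLHS]addr0 lerD ?(ltW s0)// lerD// ler_wpM2r.
  by rewrite /s mulrAC divfK ?gt_eqF// ltr_pdivrMr// ltr_pMr// ltr1n.
have [t1 r1 ts rs|t [r [ts rs E1]]] := @second_difference V f fu fuv a u v s.
  by have [[]] := H _ (near_a t1 r1 ts rs).
have near_a' r' t' : `|r'| <= `|s| -> `|t'| <= `|s| ->
    `|a - (a + r' *: v + t' *: u)| < d.
  by move=> rs' ts'; rewrite -addrA [_ *: v + _]addrC addrA; exact: near_a.
have [t1 r1 ts1 rs1|t' [r' [ts' rs' E2]]] := @second_difference V f fv fvu a v u s.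
  by have [[]] := H _ (near_a' t1 r1 ts1 rs1).
have [_ [/= h1 _]] := H _ (near_a t r ts rs).
have [_ [/= _ h2]] := H _ (near_a' t' r' ts' rs').
have E : fuv (a + t *: u + r *: v) = fvu (a + t' *: v + r' *: u).
  apply/(mulfI (lt0r_neq0 s0))/(mulfI (lt0r_neq0 s0)).
  rewrite -E1 -E2 [a + s *: v + _]addrAC; ring.
rewrite (_ : fuv a - fvu a = (fuv a - fuv (a + t *: u + r *: v)) -
   (fvu a - fvu (a + t' *: v + r' *: u))); last by rewrite E; ring.
by rewrite (le_trans (ler_normB _ _))// (splitr e) lerD// ltW.
Qed.

Lemma continuous_coord (T : topologicalType) n (g : T -> 'rV[R]_n) (x : T) :
  (forall j, {for x, continuous (fun y => g y 0 j)}) ->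
  {for x, continuous g}.
Proof.
move=> gc; apply/cvgrPdist_le => e e0.
have : \forall y \near x, forall j, `|g x 0 j - g y 0 j| <= e.
  by apply: filter_forall => j; exact: ((cvgrPdist_le _ _).1 (gc j)).
apply: filterS => y gy.
rewrite /Num.Def.normr/= mx_normrE (bigmax_le _ (ltW e0))//= => -[i j] _.
by rewrite !mxE ord1.
Qed.

Lemma telescope_partial n (f : 'rV[R]_n -> R) (a : 'rV[R]_n) (d : R) :
  (forall x, `|x - a| < d -> forall i, derivable f x (evec i)) ->
  forall y, `|y - a| < d -> exists xi : 'I_n -> 'rV[R]_n,
    (forall i, `|xi i - a| <= `|y - a|) /\
    f y - f a = \sum_i (y 0 i - a 0 i) * 'D_(evec i) f (xi i).
Proof.
move=> df y yd.
pose P (k : nat) : 'rV[R]_n := \row_j (if (j < k)%N then y 0 j else a 0 j).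
have coordle (j : 'I_n) : `|y 0 j - a 0 j| <= `|y - a|.
  have -> : y 0 j - a 0 j = (y - a) 0 j by rewrite !mxE.
  rewrite [leRHS]/Num.Def.normr/= mx_normrE.
  exact: (le_bigmax _ (fun ij => `|(y - a) ij.1 ij.2|) (0, j)).
have step (i : 'I_n) : exists2 xi, `|xi - a| <= `|y - a| &
    f (P i.+1) - f (P i) = (y 0 i - a 0 i) * 'D_(evec i) f xi.
  have PS : P i.+1 = P i + (y 0 i - a 0 i) *: evec i.
    apply/rowP => j; rewrite !mxE eqxx /= ltnS leq_eqVlt (inj_eq val_inj).
    have [->|ji] := eqVneq j i; first by rewrite ltnn /= mulr1 addrC subrK.
    by rewrite mulr0 addr0.
  have bnd t : `|t| <= `|y 0 i - a 0 i| -> `|P i + t *: evec i - a| <= `|y - a|.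
    move=> tb; rewrite [leLHS]/Num.Def.normr/= mx_normrE bigmax_le//= => -[k j] _.
    rewrite !mxE /= ord1 eqxx /=.
    have [->|ji] := eqVneq j i.
      by rewrite ltnn mulr1 addrC addKr (le_trans tb).
    rewrite mulr0 addr0; case: ifP => _ //.
    by rewrite subrr normr0.
  have [t|t tb E] := @mvt_line _ f (P i) (evec i) (y 0 i - a 0 i).
    by move=> tb; apply: df; exact: le_lt_trans (bnd _ tb) yd.
  by exists (P i + t *: evec i); rewrite ?bnd// PS E.
have [xi xi1 xi2] : exists2 xi : 'I_n -> 'rV[R]_n,
    (forall i, `|xi i - a| <= `|y - a|) &
    forall i : 'I_n, f (P i.+1) - f (P i) = (y 0 i - a 0 i) * 'D_(evec i) f (xi i).
  exists (fun i => sval (cid2 (step i))) => i; by case: cid2.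
exists xi; split=> //; under eq_bigr do rewrite -xi2.
have P0 : P 0%N = a by apply/rowP => j; rewrite mxE.
have Pn : P n = y by apply/rowP => j; rewrite mxE ltn_ord.
by rewrite -{1}Pn -{1}P0 -(telescope_sumr (fun k => f (P k)))// big_mkord.
Qed.

Lemma chain_rule (V : normedModType R) n (g : V -> 'rV[R]_n) (f : 'rV[R]_n -> R)
    (x v : V) :
  (forall j, derivable (fun y => g y 0 j) x v) ->
  (\forall y \near g x, forall j, derivable f y (evec j)) ->
  (forall j, {for g x, continuous (fun y => 'D_(evec j) f y)}) ->
  is_derive x v (f \o g)
    (\sum_j 'D_v (fun y => g y 0 j) x * 'D_(evec j) f (g x)).
Proof.
move=> dg /(nbhs_normP _ _).1 [d /= d0 df] cf.
have df' y : `|y - g x| < d -> forall j, derivable f y (evec j).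
  by move=> yd; apply: df; rewrite /= distrC.
have /choice[xi Hxi] : forall y, exists xi : 'I_n -> 'rV[R]_n,
   `|y - g x| < d -> (forall i, `|xi i - g x| <= `|y - g x|) /\
     f y - f (g x) = \sum_i (y 0 i - g x 0 i) * 'D_(evec i) f (xi i).
  move=> y; have [yd|yd] := ltP `|y - g x| d; last by exists (fun=> 0).
  by have [xi ?] := telescope_partial df' yd; exists xi.
have gcv : g (h *: v + x) @[h --> (0:R)^'] --> g x.
  apply/cvgrPdist_le => e e0.
  have : \forall h \near (0:R)^', forall j, `|g x 0 j - g (h *: v + x) 0 j| <= e.
    apply: filter_forall => j; move: e e0; apply/cvgrPdist_le.
    have E : (g (h *: v + x) 0 j) @[h --> (0:R)^'] -->
       (0 * 'D_v (fun y => g y 0 j) x + g x 0 j).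
      have Z : h @[h --> (0:R)^'] --> (0 : R) by exact: cvg_within.
      have L : (h * (h^-1 *: (((fun y => g y 0 j) \o shift x) (h *: v) - g x 0 j))
          + g x 0 j) @[h --> (0:R)^'] --> (0 * 'D_v (fun y => g y 0 j) x + g x 0 j).
        by apply: cvgD; [apply: cvgM => //; exact: dg|exact: cvg_cst].
      apply: cvg_trans L; apply: near_eq_cvg; near=> h.
      have h0 : h != 0 by near: h; exact: nbhs_dnbhs_neq.
      by rewrite /= [_ *: _]mulrC mulrCA mulfV// mulr1 subrK.
    by move: E; rewrite mul0r add0r.
  apply: filterS => h gh.
  rewrite /Num.Def.normr/= mx_normrE (bigmax_le _ (ltW e0))//= => -[i j] _.
  by rewrite !mxE ord1.
have near_d : \forall h \near (0:R)^', `|g (h *: v + x) - g x| < d.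
  move/cvgrPdist_lt : gcv => /(_ _ d0) gd.
  by near=> h; rewrite distrC; near: h.
have xicv i : xi (g (h *: v + x)) i @[h --> (0:R)^'] --> g x.
  apply/cvgrPdist_le => e e0.
  move/cvgrPdist_le : gcv => /(_ _ e0) ge.
  near=> h; have hd : `|g (h *: v + x) - g x| < d by near: h.
  by rewrite distrC (le_trans ((Hxi _ hd).1 i))// distrC; near: h.
have main : h^-1 *: ((f \o g) (h *: v + x) - (f \o g) x) @[h --> (0:R)^'] -->
   \sum_j 'D_v (fun y => g y 0 j) x * 'D_(evec j) f (g x).
  have S : \sum_j ((h^-1 *: (g (h *: v + x) 0 j - g x 0 j)) *
                  'D_(evec j) f (xi (g (h *: v + x)) j)) @[h --> (0:R)^'] -->
           \sum_j 'D_v (fun y => g y 0 j) x * 'D_(evec j) f (g x).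
    apply: cvg_big => [|j _]; first exact: add_continuous.
    apply: cvgM; first exact: dg.
    exact: (cvg_comp _ _ (xicv j) (cf j)).
  apply: cvg_trans S; apply: near_eq_cvg; near=> h.
  have hd : `|g (h *: v + x) - g x| < d by near: h.
  rewrite /= (Hxi _ hd).2 scaler_sumr; apply: eq_bigr => j _.
  by rewrite scalerAl.
split; last exact: cvg_lim.
by apply/cvg_ex; eexists; exact: main.
Unshelve. all: by end_near. Qed.

Lemma Ck_comp m n k (O : set 'rV[R]_m) (O' : set 'rV[R]_n)
    (g : 'rV[R]_m -> 'rV[R]_n) (f : 'rV[R]_n -> R) :
  open O -> open O' -> (forall x, O x -> O' (g x)) ->
  (forall j, Ck k O (fun x => g x 0 j)) -> Ck k O' f -> Ck k O (f \o g).
Proof.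
move=> oO oO' gO; elim: k f => [|k IH] f cg cf.
  split=> // x Ox; apply: continuous_comp.
    by apply: continuous_coord => j; exact: (Ck_cont (cg j)).
  by apply: (Ck_cont cf); exact/mem_set/gO/set_mem.
have der x i : O x -> is_derive x (evec i) (f \o g)
    (\sum_j 'D_(evec i) (fun y => g y 0 j) x * 'D_(evec j) f (g x)).
  move=> Ox; have [_ cf1] := cf; apply: chain_rule.
  - by move=> j; have [_ /(_ i)[h _]] := cg j; exact: h.
  - apply: filterS (open_nbhs_nbhs (conj oO' (gO _ Ox))) => y O'y j.
    by have [h _] := cf1 j; exact: h.
  - move=> j; have [_ h] := cf1 j; apply: (Ck_cont h); exact/mem_set/gO.
split=> [x Ox|i].
  apply: continuous_comp.
    by apply: continuous_coord => j; exact: (Ck_cont (cg j)).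
  by apply: (Ck_cont cf); exact/mem_set/gO/set_mem.
split=> [x Ox|]; first by have [] := der x i Ox.
apply: (@Ck_ext _ _ _ (fun x =>
  \sum_j 'D_(evec i) (fun y => g y 0 j) x * 'D_(evec j) f (g x))) => // [x Ox|].
  by have [_ ->] := der x i Ox.
apply: Ck_sum => // j; apply: Ck_mul => //.
  by have [_ /(_ i)[_]] := cg j.
apply: (IH (fun y => 'D_(evec j) f y)); first by move=> l; exact: CkS.
by have [_ /(_ j)[_]] := cf.
Qed.

Lemma Ck_local m k (O : set 'rV[R]_m) f :
  (forall x, O x -> exists A, [/\ A x, A `<=` O & Ck k A f]) -> Ck k O f.
Proof.
elim: k f => [|k IH] f H; have cf : {in O, continuous f}.
- move=> x /set_mem /H [A [Ax _ cf]]; exact: (Ck_cont cf) (mem_set Ax).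
- by [].
- move=> x /set_mem /H [A [Ax _ cf]]; exact: (Ck_cont cf) (mem_set Ax).
split=> // i; split=> [x /H [A [Ax _ [_ /(_ i)[h _]]]]|]; first exact: h.
apply: IH => x /H [A [Ax AO [_ /(_ i)[_ h]]]]; by exists A.
Qed.

Lemma smooth_derivable m (O : set 'rV[R]_m) f i x :
  smooth_on O f -> O x -> derivable f x (evec i).
Proof. by move=> /(_ 1%N)[_ /(_ i)[h _]]; exact: h. Qed.

Lemma smooth_derive m (O : set 'rV[R]_m) f i :
  smooth_on O f -> smooth_on O (fun x => 'D_(evec i) f x).
Proof. by move=> sf k; have [_ /(_ i)[]] := sf k.+1. Qed.

Lemma smooth_schwarz m (O : set 'rV[R]_m) f i j x : open O ->
  smooth_on O f -> O x ->
  'D_(evec i) (fun y => 'D_(evec j) f y) x = 'D_(evec j) (fun y => 'D_(evec i) f y) x.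
Proof.
move=> oO sf Ox.
pose D := fun (k : 'I_m) (h : 'rV[R]_m -> R) y => 'D_(evec k) h y.
apply: (@schwarz _ f (D j f) (D i f) (D i (D j f)) (D j (D i f)) x (evec j) (evec i)).
- apply: filterS (open_nbhs_nbhs (conj oO Ox)) => y Oy.
  have d1 k : derivable f y (evec k) by exact: smooth_derivable sf Oy.
  have d2 k l : derivable (D l f) y (evec k).
    exact: smooth_derivable (smooth_derive l sf) Oy.
  by split; exact: derivableP.
- exact: (Ck_cont (smooth_derive i (smooth_derive j sf) 0%N)) (mem_set Ox).
- exact: (Ck_cont (smooth_derive j (smooth_derive i sf) 0%N)) (mem_set Ox).
Qed.

End Calculus.

Section Manifolds.
Context {R : realType}.

(* coord and param are total functions; only their restrictions to dom and cod,
   which are mutually inverse homeomorphisms, are meaningful. *)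
Record chart (T : topologicalType) (m : nat) := Chart {
  dom : set T;
  cod : set 'rV[R]_m;
  coord : T -> 'rV[R]_m;
  param : 'rV[R]_m -> T;
  chart_open_dom : open dom;
  chart_open_cod : open cod;
  chart_coord_cod : forall x, dom x -> cod (coord x);
  chart_param_dom : forall y, cod y -> dom (param y);
  chart_coordK : forall x, dom x -> param (coord x) = x;
  chart_paramK : forall y, cod y -> coord (param y) = y;
  chart_coord_continuous : {within dom, continuous coord};
  chart_param_continuous : {within cod, continuous param} }.

Arguments chart_open_dom {T m} c.
Arguments chart_open_cod {T m} c.
Arguments chart_param_continuous {T m} c.

Definition transition (T : topologicalType) (m : nat) (c d : chart T m)
  (y : 'rV[R]_m) : 'rV[R]_m := coord d (param c y).

Definition overlap (T : topologicalType) (m : nat) (c d : chart T m)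
  : set 'rV[R]_m := [set y | cod c y /\ dom d (param c y)].

(* The orientation is carried by the atlas: all transition maps have positive
   Jacobian determinant. *)
Record oriented_manifold (m : nat) := OrientedManifold {
  points :> topologicalType;
  chart_index : Type;
  charts : chart_index -> chart points m;
  _ : hausdorff_space points;
  _ : @second_countable points;
  _ : connected [set: points];
  charts_cover : forall x : points, exists c, dom (charts c) x;
  charts_smooth : forall c d j,
    smooth_on (overlap (charts c) (charts d))
      (fun y => transition (charts c) (charts d) y 0 j);
  _ : forall c d y, overlap (charts c) (charts d) y ->
    0 < \det (\matrix_(i, j)
      'D_(evec i) (fun z => transition (charts c) (charts d) z 0 j) y) }.

Definition is_smooth m (M : oriented_manifold m) (f : M -> R) : Prop :=
  forall c, smooth_on (cod (charts c)) (f \o param (charts c)).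

Definition smooth_pred m (M : oriented_manifold m) : {pred M -> R} :=
  fun f => `[< is_smooth f >].

Lemma smooth_subring m (M : oriented_manifold m) :
  subring_closed (@smooth_pred m M).
Proof.
have add (f g : M -> R) : is_smooth f -> is_smooth g -> is_smooth (f + g).
  move=> sf sg c k; apply: Ck_add; [exact: chart_open_cod|exact: sf|exact: sg].
have cst (c : R) : @is_smooth m M (fun=> c) by move=> ? k; exact: Ck_cst.
have mul (f g : M -> R) : is_smooth f -> is_smooth g -> is_smooth (f * g).
  move=> sf sg c k; apply: Ck_mul; [exact: chart_open_cod|exact: sf|exact: sg].
split=> [|f g|f g]; rewrite ?unfold_in.
- exact/asboolP/cst.
- move=> /asboolP sf /asboolP sg; apply/asboolP; apply: add => //.
  by rewrite -mulN1r; apply: mul => //; exact: (cst (- 1)).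
- by move=> /asboolP sf /asboolP sg; apply/asboolP; exact: mul.
Qed.

HB.instance Definition _ m (M : oriented_manifold m) :=
  GRing.isSubringClosed.Build (M -> R) (@smooth_pred m M) (@smooth_subring m M).

Record smooth_fun m (M : oriented_manifold m) := SmoothFun {
  smooth_fun_val :> M -> R;
  smooth_funP : smooth_fun_val \in @smooth_pred m M }.

HB.instance Definition _ m (M : oriented_manifold m) :=
  [isSub for @smooth_fun_val m M].
HB.instance Definition _ m (M : oriented_manifold m) :=
  [Choice of smooth_fun M by <:].
HB.instance Definition _ m (M : oriented_manifold m) :=
  GRing.SubChoice_isSubComPzRing.Build (M -> R) (@smooth_pred m M) (smooth_fun M)
    (GRing.subringClosedP _).

Lemma smooth_fun_is_smooth m (M : oriented_manifold m) (f : smooth_fun M) : is_smooth f.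
Proof. by have := smooth_funP f; rewrite unfold_in => /asboolP. Qed.

(* Vector fields act on smooth functions as first-order differential operators
   X f = sum_i a_i * d f / d x_i with smooth coefficients in every chart.  They
   form a module over smooth_fun M; ^o is the regular module structure. *)
Definition is_vfield m (M : oriented_manifold m) (X : smooth_fun M -> (smooth_fun M)^o) :=
  forall c, exists a : 'I_m -> 'rV[R]_m -> R,
    (forall i, smooth_on (cod (charts c)) (a i)) /\
    forall f y, cod (charts c) y -> (X f : smooth_fun M) (param (charts c) y) =
      \sum_i a i y * 'D_(evec i) (f \o param (charts c)) y.

Definition vfield_pred m (M : oriented_manifold m) :
  {pred smooth_fun M -> (smooth_fun M)^o} := fun X => `[< is_vfield X >].

Lemma vfield_submod m (M : oriented_manifold m) :
  GRing.submod_closed (@vfield_pred m M).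
Proof.
split=> [|h X Y]; rewrite ?unfold_in.
  apply/asboolP => c; exists (fun=> fun=> 0); split=> [i k|f y _].
    exact: Ck_cst.
  by rewrite big1// => i _; rewrite mul0r.
move=> /asboolP vX /asboolP vY; apply/asboolP => c.
have [a [sa aE]] := vX c; have [b [sb bE]] := vY c.
exists (fun i y => h (param (charts c) y) * a i y + b i y); split=> [i k|f y cy].
  have oc := chart_open_cod (charts c).
  apply: Ck_add; [done| |exact: sb].
  by apply: Ck_mul; [done|exact: (smooth_fun_is_smooth h)|exact: sa].
rewrite /= -[LHS]/(h (param (charts c) y) * (X f : smooth_fun M) (param (charts c) y) +
   (Y f : smooth_fun M) (param (charts c) y)) aE// bE// mulr_sumr -big_split/=.
by apply: eq_bigr => i _; rewrite mulrDl mulrA.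
Qed.

HB.instance Definition _ m (M : oriented_manifold m) :=
  GRing.isSubmodClosed.Build (smooth_fun M) (smooth_fun M -> (smooth_fun M)^o) (@vfield_pred m M)
    (@vfield_submod m M).

Record vfield m (M : oriented_manifold m) := VField {
  vfield_val : smooth_fun M -> (smooth_fun M)^o;
  vfieldP : vfield_val \in @vfield_pred m M }.

HB.instance Definition _ m (M : oriented_manifold m) :=
  [isSub for @vfield_val m M].
HB.instance Definition _ m (M : oriented_manifold m) :=
  [Choice of vfield M by <:].
HB.instance Definition _ m (M : oriented_manifold m) :=
  [SubChoice_isSubLmodule of vfield M by <:].

Definition vfield_apply m (M : oriented_manifold m) (X : vfield M)
  (f : smooth_fun M) : smooth_fun M := vfield_val X f.
Coercion vfield_apply : vfield >-> Funclass.

Lemma vfield_is_vfield m (M : oriented_manifold m) (X : vfield M) :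
  is_vfield (vfield_val X).
Proof. by have := vfieldP X; rewrite unfold_in => /asboolP. Qed.

Lemma derive_combination m (O : set 'rV[R]_m) (F : 'rV[R]_m -> R)
    (b : 'I_m -> 'rV[R]_m -> R) (G : 'rV[R]_m -> R) (j : 'I_m) (y : 'rV[R]_m) :
  open O -> O y -> smooth_on O F -> (forall i, smooth_on O (b i)) ->
  (forall z, O z -> G z = \sum_i b i z * 'D_(evec i) F z) ->
  'D_(evec j) G y =
    \sum_i (b i y * 'D_(evec j) (fun z => 'D_(evec i) F z) y
            + 'D_(evec j) (b i) y * 'D_(evec i) F y).
Proof.
move=> oO Oy sF sb GE.
have dterm i : derivable (b i * (fun z => 'D_(evec i) F z)) y (evec j).
  apply: derivableM; first exact: smooth_derivable (sb i) Oy.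
  exact: smooth_derivable (smooth_derive i sF) Oy.
rewrite (@near_eq_derive _ _ _ G
    (\sum_i (b i * (fun z => 'D_(evec i) F z)))); last first.
  by apply: filterS (open_nbhs_nbhs (conj oO Oy)) => z Oz; rewrite GE// fct_sumE.
rewrite derive_sum//; apply: eq_bigr => i _.
rewrite deriveM; [|exact: smooth_derivable (sb i) Oy
                  |exact: smooth_derivable (smooth_derive i sF) Oy].
by congr (_ + _); exact: mulrC.
Qed.

Lemma lie_is_vfield m (M : oriented_manifold m) (X Y : vfield M) :
  (fun f => X (Y f) - Y (X f)) \in @vfield_pred m M.
Proof.
rewrite unfold_in; apply/asboolP => c.
have oc := chart_open_cod (charts c).
have [a [sa aE]] := vfield_is_vfield X c.
have [b [sb bE]] := vfield_is_vfield Y c.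
exists (fun i y => \sum_j a j y * 'D_(evec j) (b i) y +
   -1 * \sum_j b j y * 'D_(evec j) (a i) y); split=> [i k|f y cy].
  apply: Ck_add => //.
    apply: Ck_sum => // j; apply: Ck_mul => //; first exact: sa.
    exact: (smooth_derive j (sb i)).
  apply: Ck_mul => //; first exact: Ck_cst.
  apply: Ck_sum => // j; apply: Ck_mul => //; first exact: sb.
  exact: (smooth_derive j (sa i)).
have sF := smooth_fun_is_smooth f c.
rewrite -[LHS]/((X (Y f) : smooth_fun M) (param (charts c) y) -
   (Y (X f) : smooth_fun M) (param (charts c) y)) aE// bE//.
under eq_bigr do rewrite (derive_combination _ oc cy sF sb (bE f)) mulr_sumr.
under [X in _ - X]eq_bigr do
  rewrite (derive_combination _ oc cy sF sa (aE f)) mulr_sumr.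
under eq_bigr do under eq_bigr do rewrite mulrDr !mulrA.
under [X in _ - X]eq_bigr do under eq_bigr do rewrite mulrDr !mulrA.
under eq_bigr do rewrite big_split/=.
under [X in _ - X]eq_bigr do rewrite big_split/=.
rewrite !big_split/=.
under [RHS]eq_bigr do rewrite mulrDl mulN1r mulNr !mulr_suml.
rewrite [RHS]big_split/= sumrN.
rewrite [in X in _ = X - _]exchange_big [in X in _ = _ - X]exchange_big/=.
rewrite [X in _ - (X + _)]exchange_big/=.
rewrite [X in _ - (X + _)](_ : _ =
  \sum_j \sum_i a j y * b i y *
    'D_(evec j) (fun z => 'D_(evec i) (f \o param (charts c)) z) y).
  by rewrite opprD addrACA subrr add0r.
apply: eq_bigr => i _; apply: eq_bigr => j _.
by rewrite [b j y * _]mulrC (smooth_schwarz _ _ oc sF cy).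
Qed.

Definition lie m (M : oriented_manifold m) (X Y : vfield M) : vfield M :=
  VField (lie_is_vfield X Y).

Record smooth_map m n (M : oriented_manifold m) (N : oriented_manifold n) :=
  SmoothMap {
    smap :> M -> N;
    smap_continuous : continuous smap;
    smap_smooth : forall c d j,
      smooth_on [set y | cod (charts c) y /\ dom (charts d) (smap (param (charts c) y))]
        (fun y => coord (charts d) (smap (param (charts c) y)) 0 j) }.

Lemma pullback_smooth m n (M : oriented_manifold m) (N : oriented_manifold n)
  (pi : smooth_map M N) (h : smooth_fun N) : (h \o pi) \in @smooth_pred m M.
Proof.
rewrite unfold_in; apply/asboolP => c k; apply: Ck_local => y cy.
have [d dy] := charts_cover (pi (param (charts c) y)).
pose A := [set z | cod (charts c) z /\ dom (charts d) (pi (param (charts c) z))].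
have oA : open A.
  rewrite openE => z [cz dz].
  have pc : {for z, continuous (pi \o param (charts c))}.
    apply: continuous_comp; last exact: smap_continuous.
    have := chart_param_continuous (charts c).
    rewrite continuous_open_subspace; last exact: chart_open_cod.
    by apply; exact: mem_set.
  apply: filterI; first exact: open_nbhs_nbhs (conj (chart_open_cod _) cz).
  exact: pc (open_nbhs_nbhs (conj (chart_open_dom _) dz)).
exists A; split=> //; first by move=> z [].
pose G z := coord (charts d) (pi (param (charts c) z)).
apply: (@Ck_ext _ _ _ _ ((h \o param (charts d)) \o G)) => // [z [_ dz]|].
  by rewrite /= chart_coordK.
apply: (@Ck_comp _ _ _ _ _ (cod (charts d))) => //.
- exact: chart_open_cod.
- by move=> z [_ dz]; exact: chart_coord_cod.
- by move=> j; exact: smap_smooth.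
- exact: (smooth_fun_is_smooth h).
Qed.

Definition pullback m n (M : oriented_manifold m) (N : oriented_manifold n)
  (pi : smooth_map M N) (h : smooth_fun N) : smooth_fun M := SmoothFun (pullback_smooth pi h).

(* A metric as a symmetric form, bilinear over smooth functions, positive definite
   on each tangent space: the tangent vector of X at x is the functional
   f |-> X f x. *)
Record metric m (M : oriented_manifold m) := Metric {
  metric_form :> vfield M -> vfield M -> smooth_fun M;
  metric_sym : forall X Y, metric_form X Y = metric_form Y X;
  metric_linear : forall f X Y Z,
    metric_form (f *: X + Y) Z = f * metric_form X Z + metric_form Y Z;
  metric_ge0 : forall X x, 0 <= metric_form X X x;
  metric_eq0 : forall X x,
    metric_form X X x = 0 <-> forall f : smooth_fun M, X f x = 0 }.

Section Geometry.
Context {m : nat} {M : oriented_manifold m}.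
Implicit Types (g : metric M) (nabla : vfield M -> vfield M -> vfield M).

Definition is_levi_civita g nabla : Prop :=
  [/\ forall (f : smooth_fun M) X X' Y, nabla (f *: X + X') Y = f *: nabla X Y + nabla X' Y,
      forall X Y Y', nabla X (Y + Y') = nabla X Y + nabla X Y',
      forall (f : smooth_fun M) (X Y : vfield M), nabla X (f *: Y) = X f *: Y + f *: nabla X Y,
      forall X Y, nabla X Y - nabla Y X = lie X Y &
      forall X Y Z : vfield M, X (g Y Z) = g (nabla X Y) Z + g Y (nabla X Z)].

Definition riemann nabla (X Y Z : vfield M) : vfield M :=
  nabla X (nabla Y Z) - nabla Y (nabla X Z) - nabla (lie X Y) Z.

(* Sectional curvature of the plane spanned by X and Y at x, for any basis X, Y of
   the plane.  Where X and Y are linearly dependent the value is 0 (division by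
   zero). *)
Definition sec g nabla (X Y : vfield M) (x : M) : R :=
  g (riemann nabla X Y Y) X x / (g X X x * g Y Y x - g X Y x ^+ 2).

Definition bounded_vfield g (X : vfield M) : Prop :=
  exists C, forall x, `|g X X x| <= C.

(* Joint smoothness in (t, x) on ]-eps, eps[ x M, read in charts: the first
   coordinate of z is t. *)
Definition smooth_family (eps : R) (g : R -> metric M) : Prop :=
  forall X Y c,
    smooth_on [set z : 'rV[R]_(1 + m) |
                 - eps < lsubmx z 0 0 < eps /\ cod (charts c) (rsubmx z)]
      (fun z => g (lsubmx z 0 0) X Y (param (charts c) (rsubmx z))).

(* g_t(B_t^sharp X, Y) = B_t(X, Y) with B_t = d g_t / dt. *)
Definition is_Bsharp (g : R -> metric M) (t : R)
    (Bsharp : vfield M -> vfield M) : Prop :=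
  forall X Y x, g t (Bsharp X) Y x = derive1 (fun s : R => g s X Y x : R) t.

Definition oneill (PV PH : vfield M -> vfield M) nabla (X Y : vfield M)
    : vfield M :=
  PV (nabla (PH X) (PH Y)) + PH (nabla (PH X) (PV Y)).

End Geometry.

Section Submersions.
Context {m n : nat} {M : oriented_manifold m} {N : oriented_manifold n}.
Variable pi : smooth_map M N.
Implicit Types (g : metric M) (X Y U Z : vfield M).

(* d pi_x (X_x) = A_(pi x), both sides being functionals on functions of N. *)
Definition related_at X (x : M) (A : vfield N) : Prop :=
  forall h : smooth_fun N, X (pullback pi h) x = A h (pi x).

Definition vertical X : Prop := forall h : smooth_fun N, X (pullback pi h) = 0.

Definition horizontal g X : Prop := forall U, vertical U -> g X U = 0.

(* The first condition is surjectivity of each d pi_x, every tangent vector of N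
   being the value of a global field; A and B extend pi_* X and pi_* Y at pi x. *)
Definition is_riemannian_submersion g (gN : metric N) : Prop :=
  (forall x A, exists X, related_at X x A) /\
  (forall X Y x A B, horizontal g X -> horizontal g Y ->
     related_at X x A -> related_at Y x B -> g X Y x = gN A B (pi x)).

Definition is_horizontal_lift g (A : vfield N) X : Prop :=
  horizontal g X /\ forall x, related_at X x A.

Definition are_projections g (PV PH : vfield M -> vfield M) : Prop :=
  forall X, [/\ vertical (PV X), horizontal g (PH X) & X = PV X + PH X].

(* Only the values g t with -eps < t < eps are meaningful. *)
Definition is_variation g0 (eps : R) (g : R -> metric M) : Prop :=
  [/\ forall X Y, g 0 X Y = g0 X Y,
      forall t X Y, - eps < t < eps -> vertical X -> vertical Y ->
        g t X Y = g0 X Y &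
      smooth_family eps g].

(* The Lie derivative along Z of g restricted to vertical fields vanishes.  As
   vertical fields are exactly the fields tangent to the fibers, this says that
   on each fiber (F_x, g) the restriction of Z is a Killing field. *)
Definition killing_on_fibers g Z : Prop :=
  forall X Y, vertical X -> vertical Y ->
    Z (g X Y) = g (lie Z X) Y + g X (lie Z Y).

(* The second fundamental form of the fibers, the horizontal part of nabla X Y
   for vertical X and Y, is zero. *)
Definition totally_geodesic_fibers (nabla : vfield M -> vfield M -> vfield M)
    : Prop :=
  forall X Y, vertical X -> vertical Y -> vertical (nabla X Y).

End Submersions.

(* Existence of the derivatives at t up to order k, the k-th one being l. *)
Definition has_nth_derive (k : nat) (f : R -> R) (t l : R) : Prop :=
  (forall j, (j < k)%N -> derivable (derive1n j f) t 1) /\ derive1n k f t = l.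

End Manifolds.

Arguments oriented_manifold : clear implicits.

(* Main.v *)
(** Differentiating g_t(X, pi^*W_i) for vertical X and using the formula for B_t^sharp
    shows that the g_t-vertical part of pi^*W_i is t V_i, so W_i^t = pi^*W_i - t V_i is
    affine in t.  Hence the vertical part of [W_i^t, W_j^t] is a quadratic polynomial in
    s - t whose coefficients are vertical fields: itself at s = t, the field
    sum_k g_N([W_i,W_j],W_k) V_k - [V_i,W_j^t] - [W_i^t,V_j], and [V_i,V_j].  On vertical
    fields g_s = g_0, so every quantity of the theorem is a quartic polynomial in s - t:
    O'Neill's formulas express it through these brackets.  The fibers stay totally
    geodesic because this means that each W_i^t is Killing along the fibers, and
    subtracting the Killing field t V_i preserves that. *)
Require Import Defs.
From mathcomp Require Import all_boot all_order all_algebra.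
From mathcomp Require Import all_classical all_reals all_analysis.
From mathcomp Require Import ring lra.
Set Implicit Arguments.
Unset Strict Implicit.
Unset Printing Implicit Defensive.
Import Order.TTheory GRing.Theory Num.Theory.
Import numFieldNormedType.Exports.
Local Open Scope classical_set_scope.
Local Open Scope ring_scope.

(** * Derivatives of polynomial functions of one real variable *)

Section RealCalculus.
Context {R : realType}.
Implicit Types (f : R -> R) (a b t : R).

Lemma near_in_itv a b t : a < t < b -> \forall s \near t, a < s < b.
Proof.
move=> tab; have : t \in `]a, b[ by rewrite in_itv.
by move=> /near_in_itvoo; apply: filterS => s; rewrite in_itv.
Qed.

(** Differentiation is local: agreement on an open interval passes to the derivatives on that whole
    interval, so induction on the order goes through. *)
Lemma has_nth_derive_horner f (q : {poly R}) a b t k : a < t < b ->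
  (forall s, a < s < b -> f s = q.[s]) -> has_nth_derive k f t (derivn k q).[t].
Proof.
move=> tab fq.
have E j : forall s, a < s < b -> derive1n j f s = (derivn j q).[s].
  elim: j => [|j IH] s sab; first exact: fq.
  rewrite derive1nS derivnS derivE !derive1E; apply: near_eq_derive.
  by have := near_in_itv sab; apply: filterS => r; exact: IH.
split; last exact: E.
move=> j _; apply: (@near_eq_derivable R R R (horner (derivn j q)) _ t 1);
  last exact: derivable_horner.
by have := near_in_itv tab; apply: filterS => r rab; rewrite E.
Qed.

(** Taylor expansion at [t]: composing with ['X - t%:P] commutes with formal derivation, so
    evaluation at [t] picks out a coefficient of [p]. *)
Lemma has_nth_derive_centered f (p : {poly R}) a b t k : a < t < b ->
  (forall s, a < s < b -> f s = p.[s - t]) ->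
  has_nth_derive k f t (p`_k *+ k`!).
Proof.
move=> tab fp.
have D j : derivn j (p \Po ('X - t%:P)) = derivn j p \Po ('X - t%:P).
  by elim: j => // j IH; rewrite !derivnS IH deriv_comp derivXsubC mulr1.
have -> : p`_k *+ k`! = (derivn k (p \Po ('X - t%:P))).[t].
  by rewrite D horner_comp !hornerE subrr horner_coef0 coef_derivn addn0 ffactnn.
by apply: has_nth_derive_horner tab _ => s /fp ->; rewrite horner_comp !hornerE.
Qed.

Lemma has_nth_derive_quartic f k0 k1 k2 k3 k4 a b t : a < t < b ->
  (forall s, a < s < b -> f s = k0 + k1 * (s - t) + k2 * (s - t) ^+ 2 +
     k3 * (s - t) ^+ 3 + k4 * (s - t) ^+ 4) ->
  [/\ has_nth_derive 2 f t (2 * k2), has_nth_derive 3 f t (6 * k3),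
      has_nth_derive 4 f t (24 * k4) & has_nth_derive 5 f t 0].
Proof.
move=> tab fE.
pose p := k0%:P + k1 *: 'X + k2 *: 'X^2 + k3 *: 'X^3 + k4 *: 'X^4 : {poly R}.
have D k := @has_nth_derive_centered f p a b t k tab.
have pE s : a < s < b -> f s = p.[s - t] by move=> /fE ->; rewrite !hornerE.
split.
- by have := D 2%N pE; rewrite /p !coefE /= -mulr_natr (_ : 2`! = 2)%N//;
    congr has_nth_derive; ring.
- by have := D 3%N pE; rewrite /p !coefE /= -mulr_natr (_ : 3`! = 6)%N//;
    congr has_nth_derive; ring.
- by have := D 4%N pE; rewrite /p !coefE /= -mulr_natr (_ : 4`! = 24)%N//;
    congr has_nth_derive; ring.
- by have := D 5%N pE; rewrite /p !coefE /= !mulr0 !addr0 mul0rn.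
Qed.

Lemma is_derive0_cst f eps s t : - eps < s < eps -> - eps < t < eps ->
  (forall r, - eps < r < eps -> is_derive r 1 f 0) -> f s = f t.
Proof.
(* Both values are compared with the value at 0, which lies in the symmetric interval; [mvt_line]
   then applies with base point 0. *)
suff H r : - eps < r < eps -> (forall r, - eps < r < eps -> is_derive r 1 f 0) ->
    f r = f 0.
  by move=> sI tI df; rewrite (H s)// (H t).
move=> rI df.
have inI u : `|u| <= `|r| -> - eps < u < eps.
  by move=> ur; rewrite -ltr_norml (le_lt_trans ur)// ltr_norml.
have lineE u : 0 + u *: 1 = u :> R by rewrite add0r scaler1.
have [u ur|u ur] := @mvt_line R R f 0 1 r.
  by rewrite lineE; have [] := df u (inI u ur).
rewrite !lineE; have [_ ->] := df u (inI u ur).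
by rewrite mulr0 => /eqP; rewrite subr_eq0 => /eqP.
Qed.

End RealCalculus.

(** * Calculus of smooth functions, vector fields and metrics *)

Section VectorFields.
Context {R : realType} {m : nat} {M : oriented_manifold R m}.
Implicit Types (f h : smooth_fun M) (X Y Z : vfield M) (g : metric M).

Lemma smooth_fun_ext f h : (forall x, f x = h x) -> f = h.
Proof. by move=> fh; apply/val_inj/funext. Qed.

Lemma smooth_fun_at x f h : f = h -> f x = h x.
Proof. by move=> ->. Qed.

Lemma vfield_ext X Y : (forall f, X f = Y f) -> X = Y.
Proof. by move=> XY; apply/val_inj/funext. Qed.

Lemma const_smooth (c : R) : (fun=> c) \in @smooth_pred R m M.
Proof. by rewrite unfold_in; apply/asboolP => ? k; exact: Ck_cst. Qed.

(** Real numbers act on vector fields through constant functions, since the scalars of [vfield M]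
    are smooth functions. *)
Definition const_fun (c : R) : smooth_fun M := SmoothFun (const_smooth c).

Lemma addf_apply f h x : (f + h) x = f x + h x. Proof. by []. Qed.
Lemma oppf_apply f x : (- f) x = - f x. Proof. by []. Qed.
Lemma mulf_apply f h x : (f * h) x = f x * h x. Proof. by []. Qed.
Lemma const_apply (c : R) (x : M) : const_fun c x = c. Proof. by []. Qed.

Definition smooth_funE := (addf_apply, oppf_apply, mulf_apply, const_apply).

Lemma sumf_apply (I : Type) (r : seq I) (F : I -> smooth_fun M) x :
  (\sum_(i <- r) F i) x = \sum_(i <- r) F i x.
Proof. by elim/big_rec2: _ => // i a b _ <-. Qed.

Lemma sumv_apply (I : Type) (r : seq I) (F : I -> vfield M) f :
  (\sum_(i <- r) F i) f = \sum_(i <- r) F i f.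
Proof. by elim/big_rec2: _ => // i a b _ <-. Qed.

Lemma in_chart (x : M) :
  exists (c : chart_index M) y, cod (charts c) y /\ x = param (charts c) y.
Proof.
have [c cx] := charts_cover x; exists c, (Defs.coord (charts c) x).
by split; [exact: chart_coord_cod|rewrite chart_coordK].
Qed.

(** Vector fields are maps on functions with a first-order form in charts, so additivity and, below,
    the Leibniz rule are read off in a chart. *)
Lemma vfieldD X f h : X (f + h) = X f + X h.
Proof.
apply: smooth_fun_ext => x; have [c [y [cy ->]]] := in_chart x.
have [a [_ aE]] := vfield_is_vfield X c.
have sf := smooth_fun_is_smooth f c; have sh := smooth_fun_is_smooth h c.
rewrite -[RHS]/((X f) (param (charts c) y) + (X h) (param (charts c) y)).
rewrite /vfield_apply !aE// -big_split/=; apply: eq_bigr => i _.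
rewrite -mulrDr; congr (_ * _).
rewrite -deriveD; [by []|exact: smooth_derivable sf cy|exact: smooth_derivable sh cy].
Qed.

Lemma vfieldM X f h : X (f * h) = f * X h + h * X f.
Proof.
apply: smooth_fun_ext => x; have [c [y [cy ->]]] := in_chart x.
have [a [_ aE]] := vfield_is_vfield X c.
have sf := smooth_fun_is_smooth f c; have sh := smooth_fun_is_smooth h c.
rewrite -[RHS]/(f (param (charts c) y) * (X h) (param (charts c) y) +
   h (param (charts c) y) * (X f) (param (charts c) y)).
rewrite /vfield_apply !aE// !mulr_sumr -big_split/=; apply: eq_bigr => i _.
rewrite (_ : _ \o _ = (f \o param (charts c)) * (h \o param (charts c)))//.
rewrite deriveM; [|exact: smooth_derivable sf cy|exact: smooth_derivable sh cy].
by rewrite mulrDr [X in X + _]mulrCA [X in _ + X]mulrCA.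
Qed.

Lemma vfield_const X (c : R) : X (const_fun c) = 0.
Proof.
apply: smooth_fun_ext => x; have [d [y [dy ->]]] := in_chart x.
have [a [_ aE]] := vfield_is_vfield X d.
rewrite /vfield_apply aE// big1// => i _.
by rewrite (_ : _ \o _ = cst c)// derive_cst mulr0.
Qed.

Lemma vfield0 X : X 0 = 0.
Proof. by apply: (addrI (X 0)); rewrite -vfieldD !addr0. Qed.

Lemma vfield1 X : X 1 = 0.
Proof. by rewrite -(vfield_const X 1); congr (X _); exact: smooth_fun_ext. Qed.

Lemma const_funD (c d : R) : const_fun (c + d) = const_fun c + const_fun d.
Proof. exact: smooth_fun_ext. Qed.

Lemma const_funM (c d : R) : const_fun (c * d) = const_fun c * const_fun d.
Proof. exact: smooth_fun_ext. Qed.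

Lemma lieC X Y : lie X Y = - lie Y X.
Proof.
apply: vfield_ext => f.
by rewrite -[LHS]/(X (Y f) - Y (X f)) -[RHS]/(- (Y (X f) - X (Y f))) opprB.
Qed.

Lemma lieDl X Y Z : lie (X + Y) Z = lie X Z + lie Y Z.
Proof.
apply: vfield_ext => f.
rewrite -[LHS]/((X (Z f) + Y (Z f)) - Z (X f + Y f)).
rewrite -[RHS]/((X (Z f) - Z (X f)) + (Y (Z f) - Z (Y f))) vfieldD.
by rewrite opprD addrACA.
Qed.

Lemma lieDr X Y Z : lie X (Y + Z) = lie X Y + lie X Z.
Proof. by rewrite lieC lieDl opprD -!lieC. Qed.

Lemma lieZl (c : R) X Y : lie (const_fun c *: X) Y = const_fun c *: lie X Y.
Proof.
apply: vfield_ext => f.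
rewrite -[LHS]/(const_fun c * X (Y f) - Y (const_fun c * X f)).
rewrite -[RHS]/(const_fun c * (X (Y f) - Y (X f))).
by rewrite vfieldM vfield_const mulr0 addr0 mulrBr.
Qed.

Lemma lieZr (c : R) X Y : lie X (const_fun c *: Y) = const_fun c *: lie X Y.
Proof. by rewrite lieC lieZl -scalerN -lieC. Qed.

Lemma metric0l g X : g 0 X = 0.
Proof.
have := metric_linear g 1 0 0 X; rewrite scale1r addr0 mul1r => E.
by apply: (addrI (g 0 X)); rewrite -E addr0.
Qed.

Lemma metricDl g X Y Z : g (X + Y) Z = g X Z + g Y Z.
Proof. by have := metric_linear g 1 X Y Z; rewrite scale1r mul1r. Qed.

Lemma metricZl g f X Y : g (f *: X) Y = f * g X Y.
Proof. by have := metric_linear g f X 0 Y; rewrite !addr0 metric0l addr0. Qed.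

Lemma metricNl g X Y : g (- X) Y = - g X Y.
Proof. by rewrite -scaleN1r metricZl mulN1r. Qed.

Lemma metricBl g X Y Z : g (X - Y) Z = g X Z - g Y Z.
Proof. by rewrite metricDl metricNl. Qed.

Lemma metric_suml g (I : Type) (r : seq I) (F : I -> vfield M) Y :
  g (\sum_(i <- r) F i) Y = \sum_(i <- r) g (F i) Y.
Proof.
by apply: (big_morph (fun X => g X Y) (fun X Z => metricDl g X Z Y)); exact: metric0l.
Qed.

Lemma metric0r g X : g X 0 = 0.
Proof. by rewrite Defs.metric_sym metric0l. Qed.

Lemma metricDr g X Y Z : g X (Y + Z) = g X Y + g X Z.
Proof. by rewrite ![g X _]Defs.metric_sym metricDl. Qed.

Lemma metricZr g f X Y : g X (f *: Y) = f * g X Y.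
Proof. by rewrite ![g X _]Defs.metric_sym metricZl. Qed.

Lemma metricNr g X Y : g X (- Y) = - g X Y.
Proof. by rewrite ![g X _]Defs.metric_sym metricNl. Qed.

Lemma metricBr g X Y Z : g X (Y - Z) = g X Y - g X Z.
Proof. by rewrite metricDr metricNr. Qed.

Lemma metric_sumr g (I : Type) (r : seq I) (F : I -> vfield M) Y :
  g Y (\sum_(i <- r) F i) = \sum_(i <- r) g Y (F i).
Proof. by rewrite Defs.metric_sym metric_suml; under eq_bigr do rewrite Defs.metric_sym. Qed.

(** The squared length of a quadratic vector polynomial is a quartic; this yields the time
    dependence of the horizontal curvatures. *)
Lemma metric_quadratic g X Y Z (d : R) x :
  let T := X + const_fun d *: Y + const_fun (d ^+ 2) *: Z in
  g T T x = g X X x + 2 * g X Y x * d + (2 * g X Z x + g Y Y x) * d ^+ 2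
    + 2 * g Y Z x * d ^+ 3 + g Z Z x * d ^+ 4.
Proof.
rewrite /= !(metricDl, metricDr, metricZl, metricZr) !smooth_funE.
rewrite [g Y X]Defs.metric_sym [g Z X]Defs.metric_sym [g Z Y]Defs.metric_sym.
ring.
Qed.

Lemma metric_definite g X : g X X = 0 -> X = 0.
Proof.
move=> gX; apply: vfield_ext => f; apply: smooth_fun_ext => x.
by apply: (metric_eq0 g X x).1; rewrite gX.
Qed.

(** The degenerate case of the Cauchy-Schwarz inequality at a single point, where [X] may be nonzero
    elsewhere. *)
Lemma metric_null g X Y x : g X X x = 0 -> g X Y x = 0.
Proof.
move=> gX; apply/eqP/negPn/negP => b0; set b := g X Y x in b0.
(* With this multiple of [X] the squared length of the sum at [x] would be
   [g Y Y x - (g Y Y x + 1)], that is -1. *)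
have := metric_ge0 g (Y + const_fun (- (g Y Y x + 1) / (2 * b)) *: X) x.
rewrite !(metricDl, metricDr, metricZl, metricZr) [g Y X]Defs.metric_sym.
set c := const_fun _.
rewrite -[X in 0 <= X]/(g Y Y x + c x * b + (c x * b + c x * (c x * g X X x))).
rewrite gX !mulr0 addr0 -addrA -mulr2n -mulr_natl.
rewrite (_ : 2 * (c x * b) = - (g Y Y x + 1)); last by rewrite /c /=; field.
lra.
Qed.

End VectorFields.

(** * The differential of [pi] in coordinates *)

Section Pushforward.
Context {R : realType} {m n : nat}.
Context {M : oriented_manifold R m} {N : oriented_manifold R n}.
Variable pi : smooth_map M N.

(** The chain rule provides the coordinates [b] of the tangent vector d pi_x (X_x), the same for all
    [h]. *)
Lemma pushforward_coordinates (X : vfield M) x (d : chart_index N) :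
  dom (charts d) (pi x) -> exists b : 'rV[R]_n, forall h : smooth_fun N,
    X (pullback pi h) x = \sum_j b 0 j *
      'D_(evec j) (h \o param (charts d)) (Defs.coord (charts d) (pi x)).
Proof.
move=> dx; have [c [y [cy xE]]] := in_chart x.
have [a [_ aE]] := vfield_is_vfield X c.
pose G z := Defs.coord (charts d) (pi (param (charts c) z)).
pose A := [set z | cod (charts c) z /\ dom (charts d) (pi (param (charts c) z))].
have Ay : A y by split; rewrite // -xE.
have nA : nbhs y A.
  have pc : {for y, continuous (pi \o param (charts c))}.
    apply: continuous_comp; last exact: smap_continuous.
    have := @chart_param_continuous _ _ _ (charts c).
    rewrite continuous_open_subspace; last exact: (@chart_open_cod _ _ _ _).
    by apply; exact: mem_set.
  apply: filterI; first exact: open_nbhs_nbhs (conj (@chart_open_cod _ _ _ _) cy).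
  exact: pc (open_nbhs_nbhs (conj (@chart_open_dom _ _ _ _) Ay.2)).
exists (\row_j \sum_i a i y * 'D_(evec i) (fun z => G z 0 j) y) => h.
rewrite {1}xE /vfield_apply aE//.
have sh := smooth_fun_is_smooth h d.
have Gy : cod (charts d) (G y) by apply: chart_coord_cod; exact: Ay.2.
have chain i : 'D_(evec i) (pullback pi h \o param (charts c)) y =
    \sum_j 'D_(evec i) (fun z => G z 0 j) y * 'D_(evec j) (h \o param (charts d)) (G y).
  transitivity ('D_(evec i) ((h \o param (charts d)) \o G) y).
    apply: near_eq_derive; apply: filterS nA => z [_ dz].
    by rewrite /= /G chart_coordK.
  have [] := @chain_rule R _ n G (h \o param (charts d)) y (evec i).
  - by move=> j; exact: smooth_derivable (smap_smooth pi c d j) Ay.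
  - apply: filterS (open_nbhs_nbhs (conj (@chart_open_cod _ _ _ (charts d)) Gy)) => z dz j.
    exact: smooth_derivable sh dz.
  - by move=> j; exact: (Ck_cont (smooth_derive j sh 0%N)) (mem_set Gy).
  - by [].
rewrite {1}xE -/(G y).
under eq_bigr do rewrite chain mulr_sumr.
rewrite exchange_big; apply: eq_bigr => j _; rewrite mxE mulr_suml.
by apply: eq_bigr => i _; rewrite mulrA.
Qed.

Lemma vfield_coordinates (A : vfield N) y (d : chart_index N) :
  dom (charts d) y -> exists b : 'rV[R]_n, forall h : smooth_fun N,
    A h y = \sum_j b 0 j *
      'D_(evec j) (h \o param (charts d)) (Defs.coord (charts d) y).
Proof.
move=> dy; have [a [_ aE]] := vfield_is_vfield A d.
exists (\row_j a j (Defs.coord (charts d) y)) => h.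
rewrite -{1}(chart_coordK dy) /vfield_apply aE; last exact: chart_coord_cod.
by apply: eq_bigr => j _; rewrite mxE.
Qed.

(* Extends the tangent vector d pi_x (X_x) to a global field of N by freezing its
   coordinates in the frame W; no bump function is needed. *)
Lemma pushforward_span (gN : metric N) (W : 'I_n -> vfield N)
    (W_orthonormal : forall i j y, gN (W i) (W j) y = (i == j)%:R) (X : vfield M) x :
  exists c : 'I_n -> R, related_at pi X x (\sum_i const_fun (c i) *: W i).
Proof.
have [d dx] := charts_cover (pi x).
have [b bE] := pushforward_coordinates X dx.
have /choice[w wE] := fun i => vfield_coordinates (W i) dx.
pose B : 'M[R]_n := \matrix_i w i.
have combE (c : 'rV[R]_n) (h : smooth_fun N) :
    (\sum_i const_fun (c 0 i) *: W i) h (pi x) = \sum_j (c *m B) 0 j *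
      'D_(evec j) (h \o param (charts d)) (Defs.coord (charts d) (pi x)).
  rewrite sumv_apply sumf_apply.
  under [RHS]eq_bigr do rewrite mxE mulr_suml.
  rewrite exchange_big/=; apply: eq_bigr => i _.
  rewrite -[LHS]/(c 0 i * W i h (pi x)) wE mulr_sumr.
  by apply: eq_bigr => j _; rewrite !mxE mulrA.
(* The [W i] form a basis at [pi x]: a combination vanishing there has zero length, and pairing it
   with [W i] returns its coefficient, which is therefore 0. *)
have Bu : B \in unitmx.
  rewrite -row_free_unit; apply: inj_row_free => c c0; apply/rowP => i; rewrite mxE.
  have A0 : gN (\sum_i const_fun (c 0 i) *: W i) (\sum_i const_fun (c 0 i) *: W i)
      (pi x) = 0.
    apply: (metric_eq0 _ _ _).2 => h.
    by rewrite combE c0; under eq_bigr do rewrite mxE mul0r; rewrite big1.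
  have := metric_null (W i) A0; rewrite metric_suml sumf_apply (bigD1 i)//=.
  rewrite big1 => [|j ji]; rewrite metricZl !smooth_funE.
    by rewrite W_orthonormal eqxx mulr1 addr0.
  by rewrite W_orthonormal (negPf ji) mulr0.
exists (fun i => (b *m invmx B) 0 i) => h.
by rewrite combE mulmxKV// bE.
Qed.

End Pushforward.

(** * Vertical, horizontal and [pi]-related fields *)

Section VerticalFields.
Context {R : realType} {m n : nat}.
Context {M : oriented_manifold R m} {N : oriented_manifold R n}.
Variable pi : smooth_map M N.
Implicit Types (X Y Z U : vfield M) (A B : vfield N) (g : metric M).

Lemma vertical0 : vertical pi 0.
Proof. by []. Qed.

Lemma verticalD X Y : vertical pi X -> vertical pi Y -> vertical pi (X + Y).
Proof. by move=> vX vY h; rewrite -[LHS]/(X _ + Y _) vX vY addr0. Qed.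

Lemma verticalN X : vertical pi X -> vertical pi (- X).
Proof. by move=> vX h; rewrite -[LHS]/(- X _) vX oppr0. Qed.

Lemma verticalZ (f : smooth_fun M) X : vertical pi X -> vertical pi (f *: X).
Proof. by move=> vX h; rewrite -[LHS]/(f * X _) vX mulr0. Qed.

Lemma vertical_sum (I : Type) (r : seq I) (F : I -> vfield M) :
  (forall i, vertical pi (F i)) -> vertical pi (\sum_(i <- r) F i).
Proof.
move=> vF; elim/big_rec: _ => [|i X _]; first exact: vertical0.
exact: verticalD.
Qed.

Lemma vertical_lie X Y : vertical pi X -> vertical pi Y -> vertical pi (lie X Y).
Proof.
by move=> vX vY h; rewrite -[LHS]/(X (Y _) - Y (X _)) vX vY !vfield0 subr0.
Qed.

Lemma related_pullback X A (h : smooth_fun N) :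
  (forall x, related_at pi X x A) -> X (pullback pi h) = pullback pi (A h).
Proof. by move=> XA; apply: smooth_fun_ext => x; rewrite XA. Qed.

Lemma related_lie X Y A B : (forall x, related_at pi X x A) ->
  (forall x, related_at pi Y x B) -> forall x, related_at pi (lie X Y) x (lie A B).
Proof.
move=> XA YB x h.
rewrite -[LHS]/((X (Y (pullback pi h)) - Y (X (pullback pi h))) x).
by rewrite (related_pullback h YB) (related_pullback h XA) !smooth_funE XA YB.
Qed.

(** A field related to one on [N] maps pullbacks to pullbacks, and [U] annihilates these. *)
Lemma vertical_lie_related X A U :
  (forall x, related_at pi X x A) -> vertical pi U -> vertical pi (lie X U).
Proof.
move=> XA vU h; rewrite -[LHS]/(X (U _) - U (X _)).
by rewrite vU (related_pullback _ XA) vU vfield0 subr0.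
Qed.

Lemma horizontal_vertical0 g X : horizontal pi g X -> vertical pi X -> X = 0.
Proof. by move=> hX /hX; exact: metric_definite. Qed.

Lemma horizontalB g X Y :
  horizontal pi g X -> horizontal pi g Y -> horizontal pi g (X - Y).
Proof. by move=> hX hY U vU; rewrite metricBl hX// hY// subr0. Qed.

(** [are_projections] only provides a decomposition; two decompositions differ by a field both
    vertical and horizontal, which is zero. *)
Lemma projections_unique g (PV PH : vfield M -> vfield M) X Y :
  are_projections pi g PV PH -> vertical pi X -> horizontal pi g Y ->
  PV (X + Y) = X /\ PH (X + Y) = Y.
Proof.
move=> /(_ (X + Y))[vP hP E] vX hY.
have D : PV (X + Y) - X = Y - PH (X + Y).
  apply/eqP; rewrite subr_eq addrAC eq_sym subr_eq [Y + X]addrC; exact/eqP/E.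
have Z : Y - PH (X + Y) = 0.
  apply: (@horizontal_vertical0 g); first exact: horizontalB.
  by rewrite -D; apply: verticalD => //; exact: verticalN.
split; apply/eqP; rewrite -subr_eq0 ?D ?Z//.
by rewrite -opprB Z oppr0.
Qed.

End VerticalFields.

(** * Levi-Civita connections and Koszul's formula *)

Section LeviCivita.
Context {R : realType} {m : nat} {M : oriented_manifold R m}.
Variables (g : metric M) (nabla : vfield M -> vfield M -> vfield M).
Hypothesis nablaP : is_levi_civita g nabla.
Implicit Types (X Y Z : vfield M).

Lemma nabla_lie X Y : nabla X Y - nabla Y X = lie X Y.
Proof. by case: nablaP. Qed.

Lemma nabla_metric X Y Z : X (g Y Z) = g (nabla X Y) Z + g Y (nabla X Z).
Proof. by case: nablaP. Qed.

Lemma nablaDl X X' Y : nabla (X + X') Y = nabla X Y + nabla X' Y.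
Proof.
have [/(_ 1 X X' Y) E _ _ _ _] := nablaP.
by move: E; rewrite !scale1r.
Qed.

Lemma nabla0l Y : nabla 0 Y = 0.
Proof. by apply: (addrI (nabla 0 Y)); rewrite -nablaDl !addr0. Qed.

Lemma nabla0r X : nabla X 0 = 0.
Proof.
have [_ D _ _ _] := nablaP.
by apply: (addrI (nabla X 0)); rewrite -D !addr0.
Qed.

Lemma nablaZl (f : smooth_fun M) X Y : nabla (f *: X) Y = f *: nabla X Y.
Proof.
have [/(_ f X 0 Y) E _ _ _ _] := nablaP.
by move: E; rewrite nabla0l !addr0.
Qed.

Lemma nabla_suml (I : Type) (r : seq I) (F : I -> vfield M) Y :
  nabla (\sum_(i <- r) F i) Y = \sum_(i <- r) nabla (F i) Y.
Proof.
apply: (big_morph (fun X => nabla X Y) (fun X X' => nablaDl X X' Y)).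
exact: nabla0l.
Qed.

Lemma koszul X Y Z : g (nabla X Y) Z + g (nabla X Y) Z =
  X (g Y Z) + Y (g X Z) - Z (g X Y)
  + g (lie X Y) Z - g (lie X Z) Y - g (lie Y Z) X.
Proof.
rewrite !nabla_metric -!nabla_lie !metricBl.
rewrite [g Y (nabla X Z)]Defs.metric_sym [g X (nabla Y Z)]Defs.metric_sym.
rewrite [g X (nabla Z Y)]Defs.metric_sym.
ring.
Qed.

End LeviCivita.

(** * Riemannian submersions in an orthonormal frame of horizontal lifts: O'Neill's formulas *)

Section HorizontalFrame.
Context {R : realType} {m n : nat}.
Context {M : oriented_manifold R m} {N : oriented_manifold R n}.
Variables (pi : smooth_map M N) (g : metric M) (gN : metric N).
Hypothesis submersion : is_riemannian_submersion pi g gN.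
Variables (PV PH : vfield M -> vfield M).
Hypothesis projP : are_projections pi g PV PH.
Variable W : 'I_n -> vfield N.
Hypothesis W_orthonormal : forall i j y, gN (W i) (W j) y = (i == j)%:R.
Variable E : 'I_n -> vfield M.
Hypothesis E_lift : forall i, is_horizontal_lift pi g (W i) (E i).
Implicit Types (X Y Z U : vfield M).

Let E_horizontal i : horizontal pi g (E i). Proof. by case: (E_lift i). Qed.
Let E_related i : forall x, related_at pi (E i) x (W i).
Proof. by case: (E_lift i). Qed.

Lemma frame_orthonormal i j : g (E i) (E j) = (i == j)%:R.
Proof.
apply: smooth_fun_ext => x.
rewrite (submersion.2 _ _ _ _ _ (E_horizontal i) (E_horizontal j)
  (@E_related i x) (@E_related j x)) W_orthonormal.
by case: eqP.
Qed.

Lemma frame_combination (c : 'I_n -> R) j y :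
  gN (\sum_i const_fun (c i) *: W i) (W j) y = c j.
Proof.
rewrite metric_suml sumf_apply (bigD1 j)//= big1 => [|i ij].
  by rewrite metricZl !smooth_funE W_orthonormal eqxx mulr1 addr0.
by rewrite metricZl !smooth_funE W_orthonormal (negPf ij) mulr0.
Qed.

(** [A] is prescribed only at [pi x]. Its difference from the field given by [pushforward_span]
    vanishes there, so [metric_null] identifies the coefficients. *)
Lemma related_at_frame X x (A : vfield N) (h : smooth_fun N) :
  related_at pi X x A -> A h (pi x) = \sum_k gN A (W k) (pi x) * W k h (pi x).
Proof.
move=> XA; have [c Xc] := pushforward_span pi W_orthonormal X x.
pose B := \sum_i const_fun (c i) *: W i.
have AB0 : gN (A - B) (A - B) (pi x) = 0.
  by apply: (metric_eq0 _ _ _).2 => f; rewrite -[LHS]/((A f - B f) (pi x))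
    !smooth_funE -XA -Xc subrr.
have cE k : gN A (W k) (pi x) = c k.
  have := metric_null (W k) AB0; rewrite metricBl !smooth_funE frame_combination.
  by move=> /eqP; rewrite subr_eq0 => /eqP.
rewrite -XA Xc sumv_apply sumf_apply; apply: eq_bigr => k _.
by rewrite cE.
Qed.

(** The remainder [Y] is orthogonal to all [E j]. These products are the frame coefficients of its
    image under d pi, so the image is zero, and d pi is isometric on horizontal vectors. *)
Lemma horizontal_expansion Z : horizontal pi g Z -> Z = \sum_j g Z (E j) *: E j.
Proof.
move=> hZ; set S := \sum_j _; pose Y := Z - S.
have YE j : g Y (E j) = 0.
  rewrite metricBl metric_suml (bigD1 j)//= big1 => [|i ij].
    by rewrite metricZl frame_orthonormal eqxx mulr1 addr0 subrr.
  by rewrite metricZl frame_orthonormal (negPf ij) mulr0.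
have hY : horizontal pi g Y.
  apply: horizontalB => // U vU; rewrite metric_suml big1// => i _.
  by rewrite metricZl E_horizontal// mulr0.
suff : Y = 0 by move=> /eqP; rewrite subr_eq0 => /eqP.
apply: (@metric_definite _ _ _ g); apply: smooth_fun_ext => x.
have [c Yc] := pushforward_span pi W_orthonormal Y x.
have c0 j : c j = 0.
  have := submersion.2 _ _ _ _ _ hY (E_horizontal j) Yc (@E_related j x).
  by rewrite YE frame_combination.
have S0 : \sum_i const_fun (c i) *: W i = 0.
  apply: big1 => i _; apply: vfield_ext => f; apply: smooth_fun_ext => y.
  by rewrite -[LHS]/(c i * W i f y) c0 mul0r.
by rewrite (submersion.2 _ _ _ _ _ hY hY Yc Yc) S0 metric0r.
Qed.

Lemma horizontal_parseval Z Z' : horizontal pi g Z' ->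
  g Z Z' = \sum_j g Z (E j) * g Z' (E j).
Proof.
move=> hZ'; rewrite {1}(horizontal_expansion hZ') metric_sumr.
by apply: eq_bigr => j _; rewrite metricZr mulrC.
Qed.

Lemma projV_vertical X : vertical pi (PV X). Proof. by case: (projP X). Qed.
Lemma projH_horizontal X : horizontal pi g (PH X). Proof. by case: (projP X). Qed.
Lemma projVH X : X = PV X + PH X. Proof. by case: (projP X). Qed.

Lemma metric_projH X j : g (PH X) (E j) = g X (E j).
Proof.
rewrite [X in RHS]projVH metricDl [g (PV X) _]Defs.metric_sym.
by rewrite (E_horizontal _ (projV_vertical X)) add0r.
Qed.

Lemma vertical_frame X : (forall j, g X (E j) = 0) -> vertical pi X.
Proof.
move=> XE; rewrite [X]projVH [PH X](horizontal_expansion (projH_horizontal X)).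
rewrite big1 ?addr0 => [|j _]; first exact: projV_vertical.
by rewrite metric_projH XE scale0r.
Qed.

Lemma frame_ext X Y : (forall j, g X (E j) = g Y (E j)) ->
  (forall U, vertical pi U -> g X U = g Y U) -> X = Y.
Proof.
move=> hE hV; apply/eqP; rewrite -subr_eq0; apply/eqP.
apply: (@horizontal_vertical0 _ _ _ _ _ pi g).
  by move=> U vU; rewrite metricBl hV// subrr.
by apply: vertical_frame => j; rewrite metricBl hE subrr.
Qed.

Definition frame_bracket i j k : smooth_fun N := gN (lie (W i) (W j)) (W k).

(** The vertical part of [lie (E i) (E j)], by [projV_lie_frame]. Subtracting the horizontal part in
    the frame avoids any metric on [M], so these fields can be compared at different times. *)
Definition vertical_bracket i j : vfield M :=
  lie (E i) (E j) - \sum_k pullback pi (frame_bracket i j k) *: E k.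

Lemma vertical_bracket_vertical i j : vertical pi (vertical_bracket i j).
Proof.
move=> h; apply: smooth_fun_ext => x.
rewrite -[LHS]/(lie (E i) (E j) (pullback pi h) x
  - (\sum_k pullback pi (frame_bracket i j k) *: E k) (pullback pi h) x).
have L := @related_lie _ _ _ _ _ pi _ _ _ _ (@E_related i) (@E_related j) x.
rewrite L (related_at_frame _ L) sumv_apply sumf_apply.
rewrite -sumrB big1// => k _.
by rewrite -[X in _ - X]/(frame_bracket i j k (pi x) * E k (pullback pi h) x) E_related subrr.
Qed.

Lemma lie_frame_horizontal i j k :
  g (lie (E i) (E j)) (E k) = pullback pi (frame_bracket i j k).
Proof.
have := E_horizontal k (vertical_bracket_vertical i j).
rewrite metricBr metric_sumr (bigD1 k)//= big1 => [|l lk].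
  rewrite metricZr frame_orthonormal eqxx mulr1 addr0 Defs.metric_sym.
  by move=> /eqP; rewrite subr_eq0 => /eqP.
by rewrite metricZr frame_orthonormal eq_sym (negPf lk) mulr0.
Qed.

Lemma lie_frame_vertical i j U : vertical pi U ->
  g (lie (E i) (E j)) U = g (vertical_bracket i j) U.
Proof.
move=> vU; rewrite metricBl metric_suml big1 ?subr0// => k _.
by rewrite metricZl E_horizontal// mulr0.
Qed.

Lemma projV_lie_frame i j : PV (lie (E i) (E j)) = vertical_bracket i j.
Proof.
have h : horizontal pi g (\sum_k pullback pi (frame_bracket i j k) *: E k).
  move=> U vU; rewrite metric_suml big1// => k _.
  by rewrite metricZl E_horizontal// mulr0.
have [{2}<- _] := projections_unique projP (vertical_bracket_vertical i j) h.
by rewrite subrK.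
Qed.

Lemma vertical_bracketC i j : vertical_bracket i j = - vertical_bracket j i.
Proof.
rewrite /vertical_bracket opprB [lie (E j) _]lieC opprK -sumrN addrC; congr (_ + _).
apply: eq_bigr => k _; rewrite -scaleNr; congr (_ *: _).
apply: smooth_fun_ext => x.
rewrite oppf_apply /= /frame_bracket [lie (W i) _]lieC metricNl oppf_apply.
by rewrite ?opprK.
Qed.

Lemma vertical_bracketii i : vertical_bracket i i = 0.
Proof.
have : const_fun 2 *: vertical_bracket i i = 0.
  rewrite (_ : const_fun 2 = 1 + 1); last exact: smooth_fun_ext.
  by rewrite scalerDl scale1r {2}vertical_bracketC subrr.
move=> /(congr1 (fun X => const_fun 2^-1 *: X)); rewrite scaler0 scalerA.
rewrite (_ : _ * _ = 1) ?scale1r//.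
by apply: smooth_fun_ext => x; rewrite !smooth_funE mulVf.
Qed.

Variable nabla : vfield M -> vfield M -> vfield M.
Hypothesis nablaP : is_levi_civita g nabla.

Let vfield_frame X i j : X (g (E i) (E j)) = 0.
Proof. by rewrite frame_orthonormal; case: eqP => _; rewrite ?vfield0 ?vfield1. Qed.

(** O'Neill's identity that A_X Y is half the vertical part of [X,Y]: the frame products are
    constant and [lie (E k) U] is vertical, so only one bracket survives in Koszul's formula. *)
Lemma nabla_frame_vertical i j U x : vertical pi U ->
  g (nabla (E i) (E j)) U x = 2^-1 * g (vertical_bracket i j) U x.
Proof.
move=> vU; have K := koszul nablaP (E i) (E j) U.
have lE k l : g (lie (E k) U) (E l) = 0.
  rewrite Defs.metric_sym E_horizontal//.
  exact: vertical_lie_related (@E_related k) vU.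
move: K; rewrite vfield_frame !lE !E_horizontal// !vfield0 lie_frame_vertical//.
rewrite addr0 !subr0 add0r => /(smooth_fun_at x).
rewrite smooth_funE => <-.
by field.
Qed.

Lemma nabla_vertical_frame i j U x : vertical pi U ->
  g (nabla (E i) U) (E j) x = - (2^-1 * g (vertical_bracket i j) U x).
Proof.
move=> vU; rewrite -nabla_frame_vertical// -oppf_apply; congr (_ x).
have := nabla_metric nablaP (E i) U (E j).
rewrite [g U (E j)]Defs.metric_sym E_horizontal// vfield0 [g U _]Defs.metric_sym.
move=> /esym/addr0_eq.
by move=> <-; rewrite opprK.
Qed.

(** By Parseval in the frame and skew-symmetry of A_X, each factor contributes -1/2 times a vertical
    bracket. *)
Lemma metric_oneill U1 U2 i l x : vertical pi U1 -> vertical pi U2 ->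
  g (oneill PV PH nabla (E i) U1) (oneill PV PH nabla (E l) U2) x =
  4^-1 * \sum_j g (vertical_bracket i j) U1 x * g (vertical_bracket l j) U2 x.
Proof.
move=> v1 v2.
have oneillE k U : vertical pi U ->
    oneill PV PH nabla (E k) U = PH (nabla (E k) U).
  move=> vU; rewrite /oneill.
  have [PV1 PH1] := projections_unique projP (@vertical0 _ _ _ _ _ pi) (E_horizontal k).
  have h0 : horizontal pi g 0 by move=> Z _; rewrite metric0l.
  have [PV2 PH2] := projections_unique projP vU h0.
  have [PV3 _] := projections_unique projP (@vertical0 _ _ _ _ _ pi) h0.
  move: PV1 PH1 PV2 PH2 PV3; rewrite !(addr0, add0r) => _ -> -> ->.
  by rewrite (nabla0r nablaP) => ->; rewrite add0r.
rewrite !oneillE// (horizontal_parseval _ (projH_horizontal _)) sumf_apply mulr_sumr.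
apply: eq_bigr => j _; rewrite !metric_projH smooth_funE !nabla_vertical_frame//.
by field.
Qed.

(* The factor g U U x makes the formula true also where U vanishes, sec being 0 there. *)
Lemma vertizontal_sec U i x : totally_geodesic_fibers pi nabla -> vertical pi U ->
  g U U x * sec g nabla (E i) U x = 4^-1 * \sum_j g (vertical_bracket i j) U x ^+ 2.
Proof.
move=> geo vU; set F := E i.
have hW : horizontal pi g F := @E_horizontal i.
have nUU : vertical pi (nabla U U) by exact: geo.
have nWW V : vertical pi V -> g (nabla F F) V = 0.
  move=> vV; apply: smooth_fun_ext => y.
  by rewrite nabla_frame_vertical// vertical_bracketii metric0l mulr0.
have lWU : vertical pi (lie F U) by exact: vertical_lie_related (@E_related i) vU.
(* Of the three terms of [riemann], the first and third vanish because the fibers are totally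
   geodesic; the middle one becomes the squared length of [nabla U F]. *)
have T1 : g (nabla F (nabla U U)) F = 0.
  have := nabla_metric nablaP F (nabla U U) F.
  rewrite [g (nabla U U) F]Defs.metric_sym hW// vfield0.
  by rewrite [g _ (nabla F F)]Defs.metric_sym nWW// addr0 => <-.
have nWUW : g (nabla F U) F = 0.
  have := nabla_metric nablaP F U F.
  by rewrite [g U F]Defs.metric_sym hW// vfield0 [g U _]Defs.metric_sym nWW// addr0 => <-.
have T2 : g (nabla U (nabla F U)) F = - g (nabla F U) (nabla U F).
  have := nabla_metric nablaP U (nabla F U) F.
  by rewrite nWUW vfield0 => /esym/addr0_eq <-; rewrite opprK.
have T3 : g (nabla (lie F U) U) F = 0.
  by rewrite Defs.metric_sym; apply: hW; exact: geo.
have hUW : horizontal pi g (nabla U F).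
  move=> V vV; have := nabla_metric nablaP U F V.
  rewrite hW// vfield0 hW; last exact: geo.
  by rewrite addr0 => <-.
have Rm : g (riemann nabla F U U) F x = 4^-1 * \sum_j g (vertical_bracket i j) U x ^+ 2.
  rewrite /riemann !metricBl T1 T2 T3 sub0r opprK subr0.
  rewrite (horizontal_parseval _ hUW) sumf_apply mulr_sumr; apply: eq_bigr => j _.
  have -> : g (nabla U F) (E j) = g (nabla F U) (E j).
    have := nabla_lie nablaP F U => /(congr1 (fun Z => g Z (E j))).
    rewrite [g (lie _ _) _]Defs.metric_sym E_horizontal// metricBl.
    by move=> /subr0_eq ->.
  by rewrite smooth_funE nabla_vertical_frame//; field.
rewrite /sec Rm (hW _ vU) /F frame_orthonormal eqxx.
rewrite -[(1 : smooth_fun M) x]/(1 : R) -[(0 : smooth_fun M) x]/(0 : R).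
rewrite mul1r expr0n subr0.
have [U0|U0] := eqVneq (g U U x) 0; last by rewrite mulrC divfK.
rewrite U0 mul0r big1 ?mulr0// => j _.
by rewrite Defs.metric_sym metric_null// expr0n.
Qed.

(** The defect of the Killing equation for [E i] is -2 times the [E i] component of the second
    fundamental form. The Killing equation only measures vertical fields, on which all metrics of a
    variation agree. *)
Lemma totally_geodesic_killing : totally_geodesic_fibers pi nabla <->
  forall i, killing_on_fibers pi g (E i).
Proof.
have flip i X Y : vertical pi Y ->
    g (nabla X (E i)) Y = - g (E i) (nabla X Y).
  move=> vY; have := nabla_metric nablaP X (E i) Y.
  by rewrite E_horizontal// vfield0 => /esym/addr0_eq <-; rewrite opprK.
have defect i X Y : vertical pi X -> vertical pi Y ->
    E i (g X Y) - (g (lie (E i) X) Y + g X (lie (E i) Y)) =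
    - (g (E i) (nabla X Y) + g (E i) (nabla Y X)).
  move=> vX vY; rewrite (nabla_metric nablaP) -!(nabla_lie nablaP) metricBl metricBr.
  by rewrite [g X (nabla Y (E i))]Defs.metric_sym !flip//; ring.
split=> [geo i X Y vX vY|kil X Y vX vY].
  apply/eqP; rewrite -subr_eq0 defect//.
  by rewrite !E_horizontal ?addr0 ?oppr0//; exact: geo.
apply: vertical_frame => i; rewrite Defs.metric_sym.
have := defect i X Y vX vY; rewrite kil// subrr => /esym/eqP; rewrite oppr_eq0 => /eqP.
have -> : nabla Y X = nabla X Y - lie X Y.
  by rewrite -(nabla_lie nablaP) opprB addrC subrK.
rewrite metricBr [g _ (lie X Y)]E_horizontal; last exact: vertical_lie.
rewrite subr0 => H; apply: smooth_fun_ext => x; move: H => /(smooth_fun_at x).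
by rewrite addf_apply -mulr2n => /eqP; rewrite mulrn_eq0 => /eqP.
Qed.


(* Koszul's formula for g_N(nabla_(W i) W j, W k). *)
Definition christoffel i j k : smooth_fun N :=
  const_fun 2^-1 * (frame_bracket i j k - frame_bracket i k j - frame_bracket j k i).

Lemma nabla_frame_horizontal i j k :
  g (nabla (E i) (E j)) (E k) = pullback pi (christoffel i j k).
Proof.
have := koszul nablaP (E i) (E j) (E k).
rewrite !vfield_frame !lie_frame_horizontal addr0 subr0 add0r => K.
apply: smooth_fun_ext => x; move: K => /(smooth_fun_at x).
rewrite !smooth_funE -[pullback pi (christoffel i j k) x]/(2^-1 *
  (frame_bracket i j k (pi x) - frame_bracket i k j (pi x) - frame_bracket j k i (pi x))).
move=> /= <-.
by field.
Qed.

Lemma nabla_frame i j : nabla (E i) (E j) =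
  \sum_k pullback pi (christoffel i j k) *: E k + const_fun 2^-1 *: vertical_bracket i j.
Proof.
apply: frame_ext => [l|U vU].
  rewrite nabla_frame_horizontal metricDl metricZl.
  rewrite [g (vertical_bracket _ _) _]Defs.metric_sym.
  rewrite (E_horizontal _ (vertical_bracket_vertical _ _)) mulr0 addr0.
  rewrite metric_suml (bigD1 l)//= big1 => [|k kl].
    by rewrite metricZl frame_orthonormal eqxx mulr1 addr0.
  by rewrite metricZl frame_orthonormal (negPf kl) mulr0.
rewrite metricDl metricZl metric_suml big1 => [|k _].
  by apply: smooth_fun_ext => x; rewrite nabla_frame_vertical// add0r.
by rewrite metricZl E_horizontal// mulr0.
Qed.

Lemma metric_nabla_frame i j k l x :
  g (nabla (E i) (E j)) (nabla (E k) (E l)) x =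
  (\sum_q christoffel i j q * christoffel k l q) (pi x)
  + 4^-1 * g (vertical_bracket i j) (vertical_bracket k l) x.
Proof.
rewrite [nabla (E k) _]nabla_frame metricDr metric_sumr metricZr !smooth_funE.
rewrite !sumf_apply nabla_frame_vertical; last exact: vertical_bracket_vertical.
congr (_ + _); last by field.
apply: eq_bigr => q _.
by rewrite metricZr nabla_frame_horizontal !smooth_funE mulrC.
Qed.

(* The sectional curvature of N on the plane of W i and W j, written in the frame
   because no connection on N is given; horizontal_sec is then O'Neill's formula. *)
Definition frame_curvature i j : smooth_fun N :=
  W i (christoffel j j i) - \sum_k christoffel j j k * christoffel i i k
  - W j (christoffel i j i) + \sum_k christoffel i j k * christoffel j i k
  - \sum_k frame_bracket i j k * christoffel k j i.

Lemma horizontal_sec i j x : i != j -> sec g nabla (E i) (E j) x =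
  frame_curvature i j (pi x)
  - 3 / 4 * g (vertical_bracket i j) (vertical_bracket i j) x.
Proof.
move=> ij; set X := E i; set Y := E j; set v := vertical_bracket i j.
have vv : vertical pi v by exact: vertical_bracket_vertical.
(* The horizontal contributions come from [N] and form [frame_curvature]. The second and third terms
   of [riemann] add -1/4 and -1/2 of the squared length of [v], together -3/4. *)
have T1 : g (nabla X (nabla Y Y)) X x = W i (christoffel j j i) (pi x)
    - g (nabla Y Y) (nabla X X) x.
  have := nabla_metric nablaP X (nabla Y Y) X.
  move=> /(smooth_fun_at x).
  by rewrite nabla_frame_horizontal E_related smooth_funE => ->; rewrite addrK.
have T2 : g (nabla Y (nabla X Y)) X x = W j (christoffel i j i) (pi x)
    - g (nabla X Y) (nabla Y X) x.
  have := nabla_metric nablaP Y (nabla X Y) X.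
  move=> /(smooth_fun_at x).
  by rewrite nabla_frame_horizontal E_related smooth_funE => ->; rewrite addrK.
have T4 : g (nabla v Y) X x = 2^-1 * g v v x.
  have -> : nabla v Y = nabla Y v - lie Y v.
    by rewrite -(nabla_lie nablaP) opprB addrC subrK.
  rewrite metricBl [g (lie _ _) _]Defs.metric_sym E_horizontal; last first.
    exact: vertical_lie_related (@E_related j) vv.
  rewrite subr0 nabla_vertical_frame// vertical_bracketC metricNl smooth_funE.
  by rewrite mulrN opprK.
have T3 : g (nabla (lie X Y) Y) X x =
    (\sum_k frame_bracket i j k * christoffel k j i) (pi x) + 2^-1 * g v v x.
  have -> : lie X Y = \sum_k pullback pi (frame_bracket i j k) *: E k + v.
    by rewrite addrC subrK.
  rewrite (nablaDl nablaP) metricDl smooth_funE T4; congr (_ + _).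
  rewrite (nabla_suml nablaP) metric_suml !sumf_apply; apply: eq_bigr => k _.
  by rewrite (nablaZl nablaP) metricZl nabla_frame_horizontal.
rewrite /sec !frame_orthonormal !eqxx (negPf ij).
rewrite -[(1 : smooth_fun M) x]/(1 : R) -[(0 : smooth_fun M) x]/(0 : R).
rewrite mul1r expr0n subr0 divr1 /riemann 2!metricBl !smooth_funE T1 T2 T3.
rewrite !metric_nabla_frame !vertical_bracketii metric0l.
rewrite [vertical_bracket j i]vertical_bracketC metricNr -/v /frame_curvature !smooth_funE.
by field.
Qed.

(** Division by zero gives the degenerate plane the value 0; this settles equal indices among the
    horizontal curvatures. *)
Lemma sec_same X x : sec g nabla X X x = 0.
Proof. by rewrite /sec -expr2 subrr invr0 mulr0. Qed.

End HorizontalFrame.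

(** * Dependence of horizontal lifts and vertical brackets on time *)

Section Variation.
Context {R : realType}.

(** Joint smoothness is restricted to the line in the time direction through the chart point of
    [x]. *)
Lemma smooth_family_derivable m (M : oriented_manifold R m) (eps : R)
    (g : R -> metric M) (X Y : vfield M) (x : M) (t : R) :
  smooth_family eps g -> - eps < t < eps ->
  derivable (fun s : R => g s X Y x : R) t 1.
Proof.
move=> sg tI; have [c [y [cy ->]]] := in_chart x.
pose F (z : 'rV[R]_(1 + m)) : R :=
  g (lsubmx z 0 0) X Y (param (charts c) (rsubmx z)).
pose b : 'rV[R]_(1 + m) := row_mx 0 y.
pose v : 'rV[R]_(1 + m) := evec (lshift m ord0).
have lE (s : R) : lsubmx (b + s *: v) 0 0 = s.
  by rewrite mxE mxE row_mxEl !mxE !eqxx add0r mulr1.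
have rE (s : R) : rsubmx (b + s *: v) = y.
  apply/rowP => j; rewrite mxE mxE row_mxEr !mxE.
  by rewrite eq_rlshift andbF mulr0 addr0.
have dF : derivable F (b + t *: v) v.
  by apply: smooth_derivable (sg X Y c) _; split; rewrite ?lE ?rE.
have [] := derive_line dF.
rewrite (_ : (fun s : R => F (b + s *: v)) = fun s : R => g s X Y (param (charts c) y))//.
by apply/funext => s; rewrite /F lE rE.
Qed.

Context {m n : nat} {M : oriented_manifold R m} {N : oriented_manifold R n}.
Variable pi : smooth_map M N.
Implicit Types (g : metric M) (X Y U Z : vfield M).

(** The Killing equation is linear over constants; a varying factor would be differentiated by the
    brackets. *)
Lemma killing_on_fibers_sub g (c : R) X Y :
  killing_on_fibers pi g X -> killing_on_fibers pi g Y ->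
  killing_on_fibers pi g (X - const_fun c *: Y).
Proof.
move=> kX kY Z Z' vZ vZ'.
rewrite -[LHS]/(X (g Z Z') - const_fun c * Y (g Z Z')) kX// kY// -scaleNr.
rewrite (_ : - const_fun c = const_fun (- c)); last exact: smooth_fun_ext.
rewrite !lieDl !lieZl metricDl metricDr metricZl metricZr.
rewrite (_ : const_fun (- c) = - const_fun c); last exact: smooth_fun_ext.
ring.
Qed.

(** The frame brackets on [N] stay fixed and [d] is constant, so bilinearity of the bracket gives a
    quadratic polynomial in [d]. *)
Lemma vertical_bracket_sub (gN : metric N) (W : 'I_n -> vfield N)
    (E E' V : 'I_n -> vfield M) (d : R) i j :
  (forall k, E' k = E k - const_fun d *: V k) ->
  vertical_bracket pi gN W E' i j = vertical_bracket pi gN W E i j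
    + const_fun d *: (\sum_k pullback pi (frame_bracket gN W i j k) *: V k
        - (lie (V i) (E j) + lie (E i) (V j)))
    + const_fun (d ^+ 2) *: lie (V i) (V j).
Proof.
move=> E'E; rewrite /vertical_bracket.
under eq_bigr do rewrite E'E scalerBr scalerA [_ * const_fun d]mulrC -scalerA.
rewrite sumrB -scaler_sumr !E'E -!scaleNr.
rewrite (_ : - const_fun d = const_fun (- d)); last exact: smooth_fun_ext.
rewrite !lieDl !lieDr !lieZl !lieZr.
rewrite (_ : const_fun (- d) = - const_fun d); last exact: smooth_fun_ext.
rewrite expr2 const_funM.
apply: vfield_ext => f.
set S := \sum_k _; set S' := \sum_k _.
rewrite -[LHS]/(lie (E i) (E j) f + - const_fun d * lie (E i) (V j) f +
  (- const_fun d * lie (V i) (E j) f +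
    - const_fun d * (- const_fun d * lie (V i) (V j) f)) -
  (S f + - const_fun d * S' f)).
rewrite -[RHS]/(lie (E i) (E j) f - S f +
  const_fun d * (S' f - (lie (V i) (E j) f + lie (E i) (V j) f)) +
  const_fun d * const_fun d * lie (V i) (V j) f).
ring.
Qed.

Variables (g0 : metric M) (gN : metric N) (eps : R) (g : R -> metric M).
Variables (PV PH : R -> vfield M -> vfield M) (Bsharp : R -> vfield M -> vfield M).
Variables (W : 'I_n -> vfield N) (piW : 'I_n -> vfield M) (V : R -> 'I_n -> vfield M).
Hypothesis eps_gt0 : 0 < eps.
Hypothesis g_variation : is_variation pi g0 eps g.
Hypothesis pi_submersion : forall t : R, - eps < t < eps ->
  is_riemannian_submersion pi (g t) gN.
Hypothesis P_projections : forall t : R, - eps < t < eps ->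
  are_projections pi (g t) (PV t) (PH t).
Hypothesis Bsharp_sharp : forall t : R, - eps < t < eps -> is_Bsharp g t (Bsharp t).
Hypothesis piW_lift : forall i, is_horizontal_lift pi g0 (W i) (piW i).
Hypothesis W_orthonormal : forall i j y, gN (W i) (W j) y = (i == j)%:R.
Hypothesis V_vertical : forall (t : R) i, - eps < t < eps -> vertical pi (V t i).
Hypothesis Bsharp_formula : forall (t : R) X, - eps < t < eps -> vertical pi X ->
  Bsharp t X = \sum_i g0 (V t i) X *: PH t (piW i).
Hypothesis V_constant : forall (t : R) i (f : smooth_fun M) x, - eps < t < eps ->
  is_derive t 1 (fun s : R => V s i f x) 0.

Let zero_in : - eps < 0 < eps. Proof. by rewrite oppr_lt0 eps_gt0. Qed.

Lemma variation_constant s t i : - eps < s < eps -> - eps < t < eps -> V s i = V t i.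
Proof.
move=> sI tI; apply: vfield_ext => f; apply: smooth_fun_ext => x.
by apply: (@is_derive0_cst R (fun s => V s i f x) eps) => // r /V_constant.
Qed.

Lemma variation_lift t i : - eps < t < eps ->
  is_horizontal_lift pi (g t) (W i) (PH t (piW i)).
Proof.
move=> tI; have [vP hP PVH] := P_projections tI (piW i); split=> // x h.
have [_ /(_ x h) <-] := piW_lift i; rewrite [in RHS]PVH.
by rewrite -[RHS]/((PV t (piW i) (pullback pi h) + PH t (piW i) (pullback pi h)) x)
  vP add0r.
Qed.

(* d/dt g_t(X, piW i) = g_t(B_t^sharp X, piW i) = sum_k g0(V_k, X) g_t(W_k^t, W_i^t). *)
Lemma variation_vertical_metric t i X : - eps < t < eps -> vertical pi X ->
  g t X (piW i) = const_fun t * g0 (V 0 i) X.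
Proof.
move=> tI vX; apply: smooth_fun_ext => x; rewrite mulf_apply const_apply.
have [g00 gv sg] := g_variation.
(* The deviation from the claim: it vanishes at time 0, where [piW i] is horizontal, and its
   derivative is zero. *)
pose f (s : R) : R := g s X (piW i) x - s * g0 (V 0 i) X x.
suff : f t = f 0.
  have [hW _] := piW_lift i; rewrite /f mul0r subr0 g00 [g0 X _]Defs.metric_sym.
  by rewrite hW// => /subr0_eq.
apply: (@is_derive0_cst R f eps) => // r rI.
have dg : is_derive r 1 (fun s : R => g s X (piW i) x : R) (g0 (V 0 i) X x).
  apply: DeriveDef; first exact: smooth_family_derivable sg rI.
  (* Only the term [k = i] of the sum survives: the lifted frame is orthonormal for [g r], and the
     vertical part of [piW i] is orthogonal to it. *)
  rewrite -derive1E -(Bsharp_sharp rI) Bsharp_formula// metric_suml sumf_apply.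
  have lift k := variation_lift k rI.
  rewrite (bigD1 i)//= big1 => [|k ki]; rewrite metricZl smooth_funE.
    have [vP hP PVH] := P_projections rI (piW i).
    rewrite [X in g r _ X]PVH metricDr hP// add0r.
    rewrite (frame_orthonormal (pi_submersion rI) W_orthonormal lift) eqxx.
    by rewrite (variation_constant i rI zero_in) addr0 mulr1.
  have [vP hP PVH] := P_projections rI (piW i).
  have [hk _] := lift k.
  rewrite [X in g r _ X]PVH metricDr hk// add0r.
  by rewrite (frame_orthonormal (pi_submersion rI) W_orthonormal lift) (negPf ki) mulr0.
have dl : is_derive r (1 : R) (fun s : R => s * g0 (V 0 i) X x) (g0 (V 0 i) X x).
  apply: DeriveDef; first by apply: derivableM; [exact: derivable_id|exact: derivable_cst].
  rewrite (@deriveM R R id (cst (g0 (V 0 i) X x)))//.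
  by rewrite derive_cst derive_id scaler0 add0r [_ *: _]mulr1.
by have := is_deriveB dg dl; rewrite subrr.
Qed.

(** [PV t (piW i)] and [const_fun t *: V 0 i] are vertical with the same products against vertical
    fields; testing their difference [D] against itself identifies them. *)
Lemma variation_horizontal t i : - eps < t < eps ->
  PH t (piW i) = piW i - const_fun t *: V 0 i.
Proof.
move=> tI; have [vP hP PVH] := P_projections tI (piW i).
have [_ gv _] := g_variation.
pose D := PV t (piW i) - const_fun t *: V 0 i.
have vV : vertical pi (const_fun t *: V 0 i) by apply: verticalZ; exact: V_vertical.
have vD : vertical pi D by apply: verticalD => //; exact: verticalN.
have D0 : D = 0.
  apply: (@metric_definite _ _ _ (g t)); rewrite {2}/D metricBr.
  have -> : g t D (PV t (piW i)) = g t D (piW i).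
    by rewrite [X in _ = g t _ X]PVH metricDr [g t D (PH _ _)]Defs.metric_sym hP// addr0.
  rewrite variation_vertical_metric// gv// metricZr [g0 D _]Defs.metric_sym.
  by rewrite subrr.
rewrite {2}PVH; move: D0; rewrite /D => /subr0_eq ->.
by rewrite addrC addKr.
Qed.

End Variation.

(** * The curvature and O'Neill quantities as quartic polynomials in time *)

Theorem theorem4p4 (R : realType) (n p : nat)
  (M : oriented_manifold R (n + p)) (N : oriented_manifold R p)
  (pi : smooth_map M N) (g0 : metric M) (gN : metric N)
  (eps : R) (g : R -> metric M)
  (PV PH : R -> vfield M -> vfield M)
  (nabla : R -> vfield M -> vfield M -> vfield M)
  (Bsharp : R -> vfield M -> vfield M)
  (W : 'I_p -> vfield N) (piW : 'I_p -> vfield M)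
  (V : R -> 'I_p -> vfield M)
  (eps_gt0 : 0 < eps)
  (pi_submersion0 : is_riemannian_submersion pi g0 gN)
  (g_variation : is_variation pi g0 eps g)
  (pi_submersion : forall t : R, - eps < t < eps ->
     is_riemannian_submersion pi (g t) gN)
  (P_projections : forall t : R, - eps < t < eps ->
     are_projections pi (g t) (PV t) (PH t))
  (nabla_levi_civita : forall t : R, - eps < t < eps ->
     is_levi_civita (g t) (nabla t))
  (Bsharp_sharp : forall t : R, - eps < t < eps -> is_Bsharp g t (Bsharp t))
  (piW_lift : forall i, is_horizontal_lift pi g0 (W i) (piW i))
  (W_orthonormal : forall i j y, gN (W i) (W j) y = (i == j)%:R)
  (V_vertical : forall (t : R) i, - eps < t < eps -> vertical pi (V t i))
  (V_bounded : forall (t : R) i, - eps < t < eps -> bounded_vfield g0 (V t i))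
  (V_killing : forall (t : R) i, - eps < t < eps -> killing_on_fibers pi g0 (V t i))
  (Bsharp_formula : forall (t : R) X, - eps < t < eps -> vertical pi X ->
     Bsharp t X = \sum_i g0 (V t i) X *: PH t (piW i))
  (fibers_totally_geodesic : totally_geodesic_fibers pi (nabla 0))
  (V_constant : forall (t : R) i (f : smooth_fun M) x, - eps < t < eps ->
     is_derive t 1 (fun s : R => V s i f x) 0) :
  let Wt (t : R) (i : 'I_p) : vfield M := PH t (piW i) in
  let Q (t : R) (i j : 'I_p) : vfield M :=
    lie (V t i) (Wt t j) + lie (Wt t i) (V t j) in
  let c (i j k : 'I_p) (x : M) : R := gN (lie (W i) (W j)) (W k) (pi x) in
  let Phi (t : R) (i j : 'I_p) (U : vfield M) (x : M) : R :=
    \sum_k c i j k x * g0 (V t k) U x - g t (Q t i j) U x in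
  forall (t : R) (x : M), - eps < t < eps ->
  (* (a): the right-hand sides are quadratic in U while sec depends only on the
     plane, so sec carries the factor g0(U,U) = g_t(U,U), which is 1 for unit U *)
  (forall (U : vfield M) (i : 'I_p), vertical pi U ->
     let vsec (s : R) : R :=
       g0 U U x * sec (g s) (nabla s) (Wt s i) U x in
     [/\ has_nth_derive 2 vsec t
           (1 / 2 * (\sum_j Phi t i j U x ^+ 2)
            + \sum_j g t (lie (Wt t i) (Wt t j)) U x
                     * g t (lie (V t i) (V t j)) U x),
         has_nth_derive 3 vsec t
           (3 * \sum_j Phi t i j U x * g t (lie (V t i) (V t j)) U x),
         has_nth_derive 4 vsec t
           (6 * \sum_j g t (lie (V t i) (V t j)) U x ^+ 2) &
         has_nth_derive 5 vsec t 0]) /\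
  (* (b) *)
  (forall i j : 'I_p,
     let hsec (s : R) : R := sec (g s) (nabla s) (Wt s i) (Wt s j) x in
     [/\ has_nth_derive 2 hsec t
           (- (3 / 2) * (\sum_k \sum_l c i j k x * c i j l x
                                       * g0 (V t k) (V t l) x)
            + 3 * (\sum_k c i j k x * g t (V t k) (Q t i j) x)
            - 3 * g t (lie (V t i) (V t j)) (PV t (lie (Wt t i) (Wt t j))) x
            - 3 / 2 * g t (Q t i j) (Q t i j) x),
         has_nth_derive 3 hsec t
           (- 9 * (\sum_k c i j k x * g0 (V t k) (lie (V t i) (V t j)) x)
            + 9 * g t (Q t i j) (lie (V t i) (V t j)) x),
         has_nth_derive 4 hsec t
           (- 18 * g t (lie (V t i) (V t j)) (lie (V t i) (V t j)) x) &
         has_nth_derive 5 hsec t 0]) /\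
  (* (c) *)
  (forall (U1 U2 : vfield M) (i l : 'I_p), vertical pi U1 -> vertical pi U2 ->
     let AA (s : R) : R :=
       g s (oneill (PV s) (PH s) (nabla s) (Wt s i) U1)
           (oneill (PV s) (PH s) (nabla s) (Wt s l) U2) x in
     [/\ has_nth_derive 2 AA t
           ((2 * (\sum_j Phi t l j U2 x * Phi t i j U1 x)
             + 2 * (\sum_j g t (PV t (lie (Wt t l) (Wt t j))) U2 x
                           * g t (lie (V t i) (V t j)) U1 x)
             + 2 * (\sum_j g t (PV t (lie (Wt t i) (Wt t j))) U1 x
                           * g t (lie (V t l) (V t j)) U2 x)) / 4),
         has_nth_derive 3 AA t
           ((4 * (\sum_j g t (lie (V t l) (V t j)) U2 x * Phi t i j U1 x)
             + 4 * (\sum_j g t (lie (V t i) (V t j)) U1 x * Phi t l j U2 x)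
             + 2 * (\sum_j Phi t l j U2 x * g t (lie (V t i) (V t j)) U1 x)
             + 2 * (\sum_j Phi t i j U1 x * g t (lie (V t l) (V t j)) U2 x)) / 4),
         has_nth_derive 4 AA t
           (24 * (\sum_j g t (lie (V t l) (V t j)) U2 x
                         * g t (lie (V t i) (V t j)) U1 x) / 4) &
         has_nth_derive 5 AA t 0]).
Proof.
move=> Wt Q c Phi t x tI.
have [g00 gv _] := g_variation.
have zI : - eps < 0 < eps by rewrite oppr_lt0 eps_gt0.
have g0E X Y : g 0 X Y = g0 X Y by exact: g00.
have VE s i : - eps < s < eps -> V s i = V t i.
  by move=> sI; exact: (variation_constant V_constant).
have V0E i : V 0 i = V t i by exact: VE.
have vV i : vertical pi (V t i) by exact: V_vertical.
have lift s i : - eps < s < eps -> is_horizontal_lift pi (g s) (W i) (Wt s i).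
  by move=> sI; exact: (variation_lift P_projections piW_lift).
have WtH s i : - eps < s < eps -> Wt s i = piW i - const_fun s *: V t i.
  move=> sI; rewrite -V0E.
  exact: (variation_horizontal eps_gt0 g_variation pi_submersion P_projections
    Bsharp_sharp piW_lift W_orthonormal V_vertical Bsharp_formula V_constant).
(* Recentering at [r]: as [V] is constant in time, the lift is affine in [s] with slope
   [- V t i]. *)
have WtE r s i : - eps < r < eps -> - eps < s < eps ->
    Wt s i = Wt r i - const_fun (s - r) *: V t i.
  move=> rI sI; rewrite !WtH// -addrA -opprD -scalerDl -const_funD.
  by rewrite [r + _]addrC subrK.
(* [v t], [F] and [G] will be the constant, linear and quadratic coefficients of [v s] in powers of
   [s - t]; [Phi] is the product of [F] with [U]. *)
pose v s i j := vertical_bracket pi gN W (Wt s) i j.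
pose G i j := lie (V t i) (V t j).
pose S i j := \sum_k pullback pi (frame_bracket gN W i j k) *: V t k.
pose F i j := S i j - Q t i j.
have vE s i j : - eps < s < eps ->
    v s i j = v t i j + const_fun (s - t) *: F i j + const_fun ((s - t) ^+ 2) *: G i j.
  by move=> sI; apply: vertical_bracket_sub => k; exact: WtE.
have vv s i j : - eps < s < eps -> vertical pi (v s i j).
  by move=> sI; exact: (vertical_bracket_vertical W_orthonormal (fun k => lift s k sI)).
have vG i j : vertical pi (G i j) by exact: vertical_lie.
have rel i : forall y, related_at pi (Wt t i) y (W i) by have [] := lift t i tI.
have vQ i j : vertical pi (Q t i j).
  apply: verticalD; last exact: (vertical_lie_related (rel i)).
  by rewrite lieC; apply: verticalN; exact: (vertical_lie_related (rel j)).
have vS i j : vertical pi (S i j) by apply: vertical_sum => k; exact: verticalZ.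
have vF i j : vertical pi (F i j) by apply: verticalD => //; exact: verticalN.
have SE i j U : g0 (S i j) U x = \sum_k c i j k x * g0 (V t k) U x.
  by rewrite metric_suml sumf_apply; apply: eq_bigr => k _; rewrite metricZl.
have PhiE i j U : vertical pi U -> Phi t i j U x = g0 (F i j) U x.
  by move=> vU; rewrite /Phi gv// metricBl !smooth_funE SE.
have gE s i j U : - eps < s < eps -> vertical pi U -> g s (v s i j) U x =
    g0 (v t i j) U x + (s - t) * g0 (F i j) U x + (s - t) ^+ 2 * g0 (G i j) U x.
  move=> sI vU; rewrite gv//; last exact: vv.
  by rewrite (vE s)// !(metricDl, metricZl) !smooth_funE.
have lieE i j U : vertical pi U -> g t (lie (Wt t i) (Wt t j)) U x = g0 (v t i j) U x.
  move=> vU; rewrite (lie_frame_vertical gN (fun k => lift t k tI))// gv//.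
  exact: vv.
have GE i j U : vertical pi U -> g t (lie (V t i) (V t j)) U x = g0 (G i j) U x.
  by move=> vU; rewrite (gv t _ _ tI (vG i j) vU).
have PVE i j : PV t (lie (Wt t i) (Wt t j)) = v t i j.
  exact: (projV_lie_frame (P_projections t tI) W_orthonormal (fun k => lift t k tI)).
(* Geodesic fibers at time 0 make [Wt 0 i] Killing along the fibers; subtracting [s] times the
   Killing field [V t i] gives [Wt s i]. The equation passes from [g 0] to [g s] because its
   arguments are vertical. *)
have geo s : - eps < s < eps -> totally_geodesic_fibers pi (nabla s).
  move=> sI; apply/(totally_geodesic_killing (pi_submersion s sI) (P_projections s sI)
    W_orthonormal (fun k => lift s k sI) (nabla_levi_civita s sI)) => i X Y vX vY.
  have k0 : killing_on_fibers pi (g 0) (Wt 0 i).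
    exact: (totally_geodesic_killing (pi_submersion 0 zI) (P_projections 0 zI)
      W_orthonormal (fun k => lift 0 k zI) (nabla_levi_civita 0 zI)).1.
  have kV : killing_on_fibers pi (g 0) (V t i).
    by move=> Z Z' vZ vZ'; rewrite !g0E V_killing.
  have [_ relS] := lift s i sI.
  have := killing_on_fibers_sub (s - 0) k0 kV vX vY; rewrite -WtE// !g0E.
  by rewrite !gv//; exact: (vertical_lie_related relS).
split; [|split].
- move=> U i vU vsec.
  (* Each summand is the square of a quadratic polynomial, collected by powers of [s - t]. *)
  have vsecE s : - eps < s < eps -> vsec s =
      4^-1 * (\sum_j g0 (v t i j) U x ^+ 2)
      + 4^-1 * (\sum_j 2 * g0 (v t i j) U x * g0 (F i j) U x) * (s - t)
      + 4^-1 * (\sum_j (g0 (F i j) U x ^+ 2 + 2 * g0 (v t i j) U x * g0 (G i j) U x))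
          * (s - t) ^+ 2
      + 4^-1 * (\sum_j 2 * g0 (F i j) U x * g0 (G i j) U x) * (s - t) ^+ 3
      + 4^-1 * (\sum_j g0 (G i j) U x ^+ 2) * (s - t) ^+ 4.
    move=> sI; rewrite /vsec -(gv s)// (vertizontal_sec (pi_submersion s sI) W_orthonormal
      (fun k => lift s k sI) (nabla_levi_civita s sI) i x (geo s sI) vU).
    rewrite !mulr_sumr !mulr_suml -!big_split/=; apply: eq_bigr => j _.
    by rewrite -/(v s i j) gE//; ring.
  have [h2 h3 h4 h5] := has_nth_derive_quartic tI vsecE; split=> //.
  + move: h2; congr has_nth_derive.
    rewrite !mulr_sumr -big_split/=; apply: eq_bigr => j _.
    by rewrite PhiE// lieE// GE//; field.
  + move: h3; congr has_nth_derive.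
    rewrite !mulr_sumr; apply: eq_bigr => j _.
    by rewrite PhiE// GE//; field.
  + move: h4; congr has_nth_derive.
    rewrite !mulr_sumr; apply: eq_bigr => j _.
    by rewrite GE//; field.
- move=> i j hsec.
  (* The part coming from [N] is the same for all [s]. For [i = j] it is 0, matching the value 0 of
     [sec] and the vanishing bracket. *)
  pose K := if i == j then 0 else frame_curvature gN W i j (pi x).
  have hsecE s : - eps < s < eps -> hsec s =
      (K - 3 / 4 * g0 (v t i j) (v t i j) x)
      + (- (3 / 4) * (2 * g0 (v t i j) (F i j) x)) * (s - t)
      + (- (3 / 4) * (2 * g0 (v t i j) (G i j) x + g0 (F i j) (F i j) x)) * (s - t) ^+ 2
      + (- (3 / 4) * (2 * g0 (F i j) (G i j) x)) * (s - t) ^+ 3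
      + (- (3 / 4) * g0 (G i j) (G i j) x) * (s - t) ^+ 4.
    move=> sI; transitivity (K - 3 / 4 * g s (v s i j) (v s i j) x).
      rewrite /K /hsec; have [->|ij] := eqVneq i j.
        by rewrite sec_same /v vertical_bracketii metric0l mulr0 subr0.
      exact: (horizontal_sec (pi_submersion s sI) (P_projections s sI) W_orthonormal
        (fun k => lift s k sI) (nabla_levi_civita s sI)).
    rewrite (gv s _ _ sI (vv s i j sI) (vv s i j sI)) vE// metric_quadratic.
    by field.
  have [h2 h3 h4 h5] := has_nth_derive_quartic tI hsecE; split=> //.
  + move: h2; congr has_nth_derive.
    (* As [F i j = S i j - Q t i j], the first, second and last terms of the statement expand -3/2
       times the squared length of [F i j]. *)
    have -> : \sum_k \sum_l c i j k x * c i j l x * g0 (V t k) (V t l) x =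
        g0 (S i j) (S i j) x.
      rewrite SE; apply: eq_bigr => k _; rewrite Defs.metric_sym SE mulr_sumr.
      by apply: eq_bigr => l _; rewrite Defs.metric_sym mulrA.
    have -> : \sum_k c i j k x * g t (V t k) (Q t i j) x = g0 (S i j) (Q t i j) x.
      by rewrite SE; apply: eq_bigr => k _; rewrite gv.
    rewrite PVE GE; last exact: vv.
    rewrite gv// [g0 (G i j) _]Defs.metric_sym.
    rewrite !(metricBl, metricBr) !smooth_funE [g0 (Q t i j) (S i j)]Defs.metric_sym.
    by field.
  + move: h3; congr has_nth_derive.
    by rewrite -SE (gv t _ _ tI (vQ i j) (vG i j)) metricBl !smooth_funE; field.
  + move: h4; congr has_nth_derive.
    by rewrite (gv t _ _ tI (vG i j) (vG i j)); field.
- move=> U1 U2 i l v1 v2 AA.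
  (* Constant, linear and quadratic coefficients tested on a vertical field; [AA] is a sum of
     products of two such polynomials. *)
  pose a k j U := g0 (v t k j) U x.
  pose b k j U := g0 (F k j) U x.
  pose e k j U := g0 (G k j) U x.
  have AAE s : - eps < s < eps -> AA s =
      4^-1 * (\sum_j a i j U1 * a l j U2)
      + 4^-1 * (\sum_j (a i j U1 * b l j U2 + b i j U1 * a l j U2)) * (s - t)
      + 4^-1 * (\sum_j (a i j U1 * e l j U2 + b i j U1 * b l j U2 + e i j U1 * a l j U2))
          * (s - t) ^+ 2
      + 4^-1 * (\sum_j (b i j U1 * e l j U2 + e i j U1 * b l j U2)) * (s - t) ^+ 3
      + 4^-1 * (\sum_j e i j U1 * e l j U2) * (s - t) ^+ 4.
    move=> sI; rewrite /AA (metric_oneill (pi_submersion s sI) (P_projections s sI)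
      W_orthonormal (fun k => lift s k sI) (nabla_levi_civita s sI))//.
    rewrite !mulr_sumr !mulr_suml -!big_split/=; apply: eq_bigr => j _.
    by rewrite -!/(v s _ j) !gE// -!/(a _ j _) -!/(b _ j _) -!/(e _ j _); ring.
  have [h2 h3 h4 h5] := has_nth_derive_quartic tI AAE; split=> //.
  + move: h2; congr has_nth_derive.
    rewrite !mulr_sumr -!big_split/= mulr_suml; apply: eq_bigr => j _.
    by rewrite !PhiE// !PVE !GE// !(gv t (v _ _ _) _ tI (vv _ _ _ tI))//; rewrite /a /b /e; field.
  (* The weights 4 and 2 of the repeated sums add up to 6, the factorial of 3. *)
  + move: h3; congr has_nth_derive.
    rewrite !mulr_sumr -!big_split/= mulr_suml; apply: eq_bigr => j _.
    by rewrite !PhiE// !GE//; rewrite /a /b /e; field.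
  + move: h4; congr has_nth_derive.
    rewrite !mulr_sumr mulr_suml; apply: eq_bigr => j _.
    by rewrite !GE//; rewrite /a /b /e; field.
Qed.
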